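(* Work in intensional Martin-Löf type theory with propositional truncation satisfying the judgmental computation rule $\mathrm{rec}(P,h,f,|x|)\equiv f(x)$. Write $0,1:\mathbf 2$ for the booleans and $\mathsf{h}_{a,b}:a=b$ for the equality given by propositionality of $\lVert\mathbf 2\rVert$. Then $\lVert\mathbf 2\rVert$ satisfies the recursion principle of the interval: for every $Y:\mathcal U$, $y_0,y_1:Y$ and $p:y_0=y_1$ there is $f:\lVert\mathbf 2\rVert\to Y$ with $f(|0|)\equiv y_0$ and $f(|1|)\equiv y_1$ judgmentally, and $\mathrm{ap}_f(\mathsf h_{|0|,|1|})=p$. Moreover, if the truncation also has an induction principle $\mathrm{ind}$ (for families $P:\lVert X\rVert\to\mathcal U$ of propositions and $f:\prod_{x:X}P(|x|)$) with judgmental computation rule $\mathrm{ind}(P,h,f,|x|)\equiv f(x)$, then $\lVert\mathbf 2\rVert$ satisfies the induction principle of the interval: for every $P:\lVert\mathbf 2\rVert\to\mathcal U$, $a_0:P(|0|)$, $a_1:P(|1|)$ and $q:\mathrm{transport}^P(\mathsf h_{|0|,|1|},a_0)=a_1$ there is $g:\prod_{z:\lVert\mathbf 2\rVert}P(z)$ with $g(|0|)\equiv a_0$, $g(|1|)\equiv a_1$ judgmentally, and $\mathrm{apd}_g(\mathsf h_{|0|,|1|})=q$.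
   Context: Intensional Martin-Löf type theory with a universe $\mathcal U$, $\Sigma$, $\Pi$, $+$, booleans $\mathbf 2$, identity types (J only; no UIP/K) and judgmental $\eta$ for functions. $\mathrm{isProp}(A):\equiv\prod_{a,b:A}a=b$. Propositional truncation: for every $A:\mathcal U$ a type $\lVert A\rVert:\mathcal U$ with $|{-}|:A\to\lVert A\rVert$, a proof of $\mathrm{isProp}(\lVert A\rVert)$, and $\mathrm{rec}:\prod_{P:\mathcal U}\mathrm{isProp}(P)\to(A\to P)\to\lVert A\rVert\to P$. For $f:A\to B$ and $p:a=a'$, $\mathrm{ap}_f(p):f(a)=f(a')$ is the induced path; for dependent $g$, $\mathrm{apd}_g(p):\mathrm{transport}^P(p,g(a))=g(a')$; $\mathrm{transport}^P(p,-):P(a)\to P(a')$ is substitution along $p$. *)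

(* Defs.v *)
(* Stdlib only.  The statement is about judgmental equality, so the type theory
   is given as raw de Bruijn syntax together with its derivability judgments. *)
From Stdlib Require Import List.
Import ListNotations.

(* Arguments that bind variables: the codomain of Pi and Sig and the body of
   Lam (1); motives C of SigInd, SumInd, BoolInd (1) and of J (2); branches of
   SigInd (2) and of SumInd (1).  TrProp A is the proof of isProp ||A||. *)
Inductive tm : Type :=
| Var (n : nat)
| U
| Pi (A B : tm) | Lam (A b : tm) | App (f a : tm)
| Sig (A B : tm) | Pair (a b : tm) | SigInd (C d p : tm)
| Sum (A B : tm) | Inl (a : tm) | Inr (b : tm) | SumInd (C c d s : tm)
| Bool | B0 | B1 | BoolInd (C c0 c1 b : tm)
| Id (A a b : tm) | Refl (a : tm) | J (A a C d b p : tm)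
| Trunc (A : tm) | Tr (a : tm) | TrProp (A : tm)
| TrRec (A P h f t : tm)
| TrInd (A P h f t : tm).

Definition up_ren (r : nat -> nat) (n : nat) : nat :=
  match n with 0 => 0 | S m => S (r m) end.

Fixpoint ren (r : nat -> nat) (t : tm) : tm :=
  let r1 := up_ren r in
  let r2 := up_ren r1 in
  match t with
  | Var n => Var (r n)
  | U => U
  | Pi A B => Pi (ren r A) (ren r1 B)
  | Lam A b => Lam (ren r A) (ren r1 b)
  | App f a => App (ren r f) (ren r a)
  | Sig A B => Sig (ren r A) (ren r1 B)
  | Pair a b => Pair (ren r a) (ren r b)
  | SigInd C d p => SigInd (ren r1 C) (ren r2 d) (ren r p)
  | Sum A B => Sum (ren r A) (ren r B)
  | Inl a => Inl (ren r a)
  | Inr b => Inr (ren r b)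
  | SumInd C c d s => SumInd (ren r1 C) (ren r1 c) (ren r1 d) (ren r s)
  | Bool => Bool
  | B0 => B0
  | B1 => B1
  | BoolInd C c0 c1 b => BoolInd (ren r1 C) (ren r c0) (ren r c1) (ren r b)
  | Id A a b => Id (ren r A) (ren r a) (ren r b)
  | Refl a => Refl (ren r a)
  | J A a C d b p =>
      J (ren r A) (ren r a) (ren r2 C) (ren r d) (ren r b) (ren r p)
  | Trunc A => Trunc (ren r A)
  | Tr a => Tr (ren r a)
  | TrProp A => TrProp (ren r A)
  | TrRec A P h f t =>
      TrRec (ren r A) (ren r P) (ren r h) (ren r f) (ren r t)
  | TrInd A P h f t =>
      TrInd (ren r A) (ren r P) (ren r h) (ren r f) (ren r t)
  end.

Definition shift (t : tm) : tm := ren S t.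
Definition shift2 (t : tm) : tm := shift (shift t).

Definition scons (a : tm) (s : nat -> tm) (n : nat) : tm :=
  match n with 0 => a | S m => s m end.

Definition up (s : nat -> tm) : nat -> tm :=
  scons (Var 0) (fun n => shift (s n)).

Fixpoint subst (s : nat -> tm) (t : tm) : tm :=
  let s1 := up s in
  let s2 := up s1 in
  match t with
  | Var n => s n
  | U => U
  | Pi A B => Pi (subst s A) (subst s1 B)
  | Lam A b => Lam (subst s A) (subst s1 b)
  | App f a => App (subst s f) (subst s a)
  | Sig A B => Sig (subst s A) (subst s1 B)
  | Pair a b => Pair (subst s a) (subst s b)
  | SigInd C d p => SigInd (subst s1 C) (subst s2 d) (subst s p)
  | Sum A B => Sum (subst s A) (subst s B)
  | Inl a => Inl (subst s a)
  | Inr b => Inr (subst s b)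
  | SumInd C c d t' =>
      SumInd (subst s1 C) (subst s1 c) (subst s1 d) (subst s t')
  | Bool => Bool
  | B0 => B0
  | B1 => B1
  | BoolInd C c0 c1 b =>
      BoolInd (subst s1 C) (subst s c0) (subst s c1) (subst s b)
  | Id A a b => Id (subst s A) (subst s a) (subst s b)
  | Refl a => Refl (subst s a)
  | J A a C d b p =>
      J (subst s A) (subst s a) (subst s2 C) (subst s d) (subst s b) (subst s p)
  | Trunc A => Trunc (subst s A)
  | Tr a => Tr (subst s a)
  | TrProp A => TrProp (subst s A)
  | TrRec A P h f t' =>
      TrRec (subst s A) (subst s P) (subst s h) (subst s f) (subst s t')
  | TrInd A P h f t' =>
      TrInd (subst s A) (subst s P) (subst s h) (subst s f) (subst s t')
  end.

(* B[a/0] *)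
Definition inst (B a : tm) : tm := subst (scons a Var) B.
(* C[a/1, b/0] *)
Definition inst2 (C a b : tm) : tm := subst (scons b (scons a Var)) C.
(* C lives over (G, z); u lives over G extended by k variables; the result is
   C[u/z], over G extended by those k variables. *)
Definition inst_over (k : nat) (C u : tm) : tm :=
  subst (scons u (fun n => Var (k + n))) C.

Definition Arr (A B : tm) : tm := Pi A (shift B).

Definition isProp (A : tm) : tm :=
  Pi A (Pi (shift A) (Id (shift2 A) (Var 1) (Var 0))).

(* The most recently declared variable comes first. *)
Definition ctx := list tm.

Inductive lookup : ctx -> nat -> tm -> Prop :=
| lookup_here G A : lookup (A :: G) 0 (shift A)
| lookup_there G A B n : lookup G n A -> lookup (B :: G) (S n) (shift A).

(* Whether the truncation has only the recursor, or also the induction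
   principle. *)
Inductive trunc_elim : Set := RecOnly | RecAndInd.

(* Universe a la Russell, with no universe above U.  Type formers act on all
   types, U is closed under them, and eliminators other than those of the
   truncation have arbitrary types as motives.  J is based path induction.  The
   only judgmental eta rule is the one for functions. *)
Inductive wf_ctx (K : trunc_elim) : ctx -> Prop :=
| wf_nil : wf_ctx K []
| wf_cons G A : wf_ctx K G -> is_type K G A -> wf_ctx K (A :: G)

with is_type (K : trunc_elim) : ctx -> tm -> Prop :=
| ty_U G : wf_ctx K G -> is_type K G U
| ty_small G A : has_type K G A U -> is_type K G A
| ty_Pi G A B :
    is_type K G A -> is_type K (A :: G) B -> is_type K G (Pi A B)
| ty_Sig G A B :
    is_type K G A -> is_type K (A :: G) B -> is_type K G (Sig A B)
| ty_Sum G A B :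
    is_type K G A -> is_type K G B -> is_type K G (Sum A B)
| ty_Id G A a b :
    is_type K G A -> has_type K G a A -> has_type K G b A ->
    is_type K G (Id A a b)

with has_type (K : trunc_elim) : ctx -> tm -> tm -> Prop :=
| tm_conv G t A B :
    has_type K G t A -> eq_type K G A B -> has_type K G t B
| tm_Var G n A : wf_ctx K G -> lookup G n A -> has_type K G (Var n) A
| tm_Pi G A B :
    has_type K G A U -> has_type K (A :: G) B U -> has_type K G (Pi A B) U
| tm_Lam G A B b :
    is_type K G A -> is_type K (A :: G) B -> has_type K (A :: G) b B ->
    has_type K G (Lam A b) (Pi A B)
| tm_App G A B f a :
    is_type K G A -> is_type K (A :: G) B ->
    has_type K G f (Pi A B) -> has_type K G a A ->
    has_type K G (App f a) (inst B a)
| tm_Sig G A B :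
    has_type K G A U -> has_type K (A :: G) B U -> has_type K G (Sig A B) U
| tm_Pair G A B a b :
    is_type K G A -> is_type K (A :: G) B ->
    has_type K G a A -> has_type K G b (inst B a) ->
    has_type K G (Pair a b) (Sig A B)
| tm_SigInd G A B C d p :
    is_type K G A -> is_type K (A :: G) B ->
    is_type K (Sig A B :: G) C ->
    has_type K (B :: A :: G) d (inst_over 2 C (Pair (Var 1) (Var 0))) ->
    has_type K G p (Sig A B) ->
    has_type K G (SigInd C d p) (inst C p)
| tm_Sum G A B :
    has_type K G A U -> has_type K G B U -> has_type K G (Sum A B) U
| tm_Inl G A B a :
    is_type K G A -> is_type K G B -> has_type K G a A ->
    has_type K G (Inl a) (Sum A B)
| tm_Inr G A B b :
    is_type K G A -> is_type K G B -> has_type K G b B ->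
    has_type K G (Inr b) (Sum A B)
| tm_SumInd G A B C c d s :
    is_type K G A -> is_type K G B ->
    is_type K (Sum A B :: G) C ->
    has_type K (A :: G) c (inst_over 1 C (Inl (Var 0))) ->
    has_type K (B :: G) d (inst_over 1 C (Inr (Var 0))) ->
    has_type K G s (Sum A B) ->
    has_type K G (SumInd C c d s) (inst C s)
| tm_Bool G : wf_ctx K G -> has_type K G Bool U
| tm_B0 G : wf_ctx K G -> has_type K G B0 Bool
| tm_B1 G : wf_ctx K G -> has_type K G B1 Bool
| tm_BoolInd G C c0 c1 b :
    is_type K (Bool :: G) C ->
    has_type K G c0 (inst C B0) -> has_type K G c1 (inst C B1) ->
    has_type K G b Bool ->
    has_type K G (BoolInd C c0 c1 b) (inst C b)
| tm_Id G A a b :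
    has_type K G A U -> has_type K G a A -> has_type K G b A ->
    has_type K G (Id A a b) U
| tm_Refl G A a :
    is_type K G A -> has_type K G a A -> has_type K G (Refl a) (Id A a a)
| tm_J G A a C d b p :
    is_type K G A -> has_type K G a A ->
    is_type K (Id (shift A) (shift a) (Var 0) :: A :: G) C ->
    has_type K G d (inst2 C a (Refl a)) ->
    has_type K G b A -> has_type K G p (Id A a b) ->
    has_type K G (J A a C d b p) (inst2 C b p)
| tm_Trunc G A : has_type K G A U -> has_type K G (Trunc A) U
| tm_Tr G A a :
    has_type K G A U -> has_type K G a A -> has_type K G (Tr a) (Trunc A)
| tm_TrProp G A :
    has_type K G A U -> has_type K G (TrProp A) (isProp (Trunc A))
| tm_TrRec G A P h f t :
    has_type K G A U -> has_type K G P U ->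
    has_type K G h (isProp P) -> has_type K G f (Arr A P) ->
    has_type K G t (Trunc A) ->
    has_type K G (TrRec A P h f t) P
| tm_TrInd G A P h f t :
    K = RecAndInd ->
    has_type K G A U -> has_type K G P (Arr (Trunc A) U) ->
    has_type K G h (Pi (Trunc A) (isProp (App (shift P) (Var 0)))) ->
    has_type K G f (Pi A (App (shift P) (Tr (Var 0)))) ->
    has_type K G t (Trunc A) ->
    has_type K G (TrInd A P h f t) (App P t)

with eq_type (K : trunc_elim) : ctx -> tm -> tm -> Prop :=
| eqty_refl G A : is_type K G A -> eq_type K G A A
| eqty_sym G A B : eq_type K G A B -> eq_type K G B A
| eqty_trans G A B C :
    eq_type K G A B -> eq_type K G B C -> eq_type K G A C
| eqty_small G A B : eq_term K G A B U -> eq_type K G A B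
| eqty_Pi G A A' B B' :
    is_type K G A -> eq_type K G A A' -> eq_type K (A :: G) B B' ->
    eq_type K G (Pi A B) (Pi A' B')
| eqty_Sig G A A' B B' :
    is_type K G A -> eq_type K G A A' -> eq_type K (A :: G) B B' ->
    eq_type K G (Sig A B) (Sig A' B')
| eqty_Sum G A A' B B' :
    eq_type K G A A' -> eq_type K G B B' ->
    eq_type K G (Sum A B) (Sum A' B')
| eqty_Id G A A' a a' b b' :
    eq_type K G A A' -> eq_term K G a a' A -> eq_term K G b b' A ->
    eq_type K G (Id A a b) (Id A' a' b')

with eq_term (K : trunc_elim) : ctx -> tm -> tm -> tm -> Prop :=
| eq_tm_refl G t A : has_type K G t A -> eq_term K G t t A
| eq_tm_sym G t u A : eq_term K G t u A -> eq_term K G u t A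
| eq_tm_trans G t u v A :
    eq_term K G t u A -> eq_term K G u v A -> eq_term K G t v A
| eq_conv G t u A B :
    eq_term K G t u A -> eq_type K G A B -> eq_term K G t u B
(* computation rules *)
| eq_beta G A B b a :
    is_type K G A -> is_type K (A :: G) B ->
    has_type K (A :: G) b B -> has_type K G a A ->
    eq_term K G (App (Lam A b) a) (inst b a) (inst B a)
| eq_eta G A B f :
    is_type K G A -> is_type K (A :: G) B -> has_type K G f (Pi A B) ->
    eq_term K G f (Lam A (App (shift f) (Var 0))) (Pi A B)
| eq_SigInd_Pair G A B C d a b :
    is_type K G A -> is_type K (A :: G) B ->
    is_type K (Sig A B :: G) C ->
    has_type K (B :: A :: G) d (inst_over 2 C (Pair (Var 1) (Var 0))) ->
    has_type K G a A -> has_type K G b (inst B a) ->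
    eq_term K G (SigInd C d (Pair a b)) (inst2 d a b) (inst C (Pair a b))
| eq_SumInd_Inl G A B C c d a :
    is_type K G A -> is_type K G B ->
    is_type K (Sum A B :: G) C ->
    has_type K (A :: G) c (inst_over 1 C (Inl (Var 0))) ->
    has_type K (B :: G) d (inst_over 1 C (Inr (Var 0))) ->
    has_type K G a A ->
    eq_term K G (SumInd C c d (Inl a)) (inst c a) (inst C (Inl a))
| eq_SumInd_Inr G A B C c d b :
    is_type K G A -> is_type K G B ->
    is_type K (Sum A B :: G) C ->
    has_type K (A :: G) c (inst_over 1 C (Inl (Var 0))) ->
    has_type K (B :: G) d (inst_over 1 C (Inr (Var 0))) ->
    has_type K G b B ->
    eq_term K G (SumInd C c d (Inr b)) (inst d b) (inst C (Inr b))
| eq_BoolInd_B0 G C c0 c1 :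
    is_type K (Bool :: G) C ->
    has_type K G c0 (inst C B0) -> has_type K G c1 (inst C B1) ->
    eq_term K G (BoolInd C c0 c1 B0) c0 (inst C B0)
| eq_BoolInd_B1 G C c0 c1 :
    is_type K (Bool :: G) C ->
    has_type K G c0 (inst C B0) -> has_type K G c1 (inst C B1) ->
    eq_term K G (BoolInd C c0 c1 B1) c1 (inst C B1)
| eq_J_Refl G A a C d :
    is_type K G A -> has_type K G a A ->
    is_type K (Id (shift A) (shift a) (Var 0) :: A :: G) C ->
    has_type K G d (inst2 C a (Refl a)) ->
    eq_term K G (J A a C d a (Refl a)) d (inst2 C a (Refl a))
| eq_TrRec_Tr G A P h f a :
    has_type K G A U -> has_type K G P U ->
    has_type K G h (isProp P) -> has_type K G f (Arr A P) ->
    has_type K G a A ->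
    eq_term K G (TrRec A P h f (Tr a)) (App f a) P
| eq_TrInd_Tr G A P h f a :
    K = RecAndInd ->
    has_type K G A U -> has_type K G P (Arr (Trunc A) U) ->
    has_type K G h (Pi (Trunc A) (isProp (App (shift P) (Var 0)))) ->
    has_type K G f (Pi A (App (shift P) (Tr (Var 0)))) ->
    has_type K G a A ->
    eq_term K G (TrInd A P h f (Tr a)) (App f a) (App P (Tr a))
(* congruence rules *)
| eq_Pi G A A' B B' :
    has_type K G A U -> eq_term K G A A' U -> eq_term K (A :: G) B B' U ->
    eq_term K G (Pi A B) (Pi A' B') U
| eq_Lam G A A' B b b' :
    is_type K G A -> eq_type K G A A' ->
    is_type K (A :: G) B -> eq_term K (A :: G) b b' B ->
    eq_term K G (Lam A b) (Lam A' b') (Pi A B)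
| eq_App G A B f f' a a' :
    is_type K G A -> is_type K (A :: G) B ->
    eq_term K G f f' (Pi A B) -> eq_term K G a a' A ->
    eq_term K G (App f a) (App f' a') (inst B a)
| eq_Sig G A A' B B' :
    has_type K G A U -> eq_term K G A A' U -> eq_term K (A :: G) B B' U ->
    eq_term K G (Sig A B) (Sig A' B') U
| eq_Pair G A B a a' b b' :
    is_type K G A -> is_type K (A :: G) B ->
    eq_term K G a a' A -> eq_term K G b b' (inst B a) ->
    eq_term K G (Pair a b) (Pair a' b') (Sig A B)
| eq_SigInd G A B C C' d d' p p' :
    is_type K G A -> is_type K (A :: G) B ->
    is_type K (Sig A B :: G) C -> eq_type K (Sig A B :: G) C C' ->
    eq_term K (B :: A :: G) d d' (inst_over 2 C (Pair (Var 1) (Var 0))) ->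
    eq_term K G p p' (Sig A B) ->
    eq_term K G (SigInd C d p) (SigInd C' d' p') (inst C p)
| eq_Sum G A A' B B' :
    eq_term K G A A' U -> eq_term K G B B' U ->
    eq_term K G (Sum A B) (Sum A' B') U
| eq_Inl G A B a a' :
    is_type K G A -> is_type K G B -> eq_term K G a a' A ->
    eq_term K G (Inl a) (Inl a') (Sum A B)
| eq_Inr G A B b b' :
    is_type K G A -> is_type K G B -> eq_term K G b b' B ->
    eq_term K G (Inr b) (Inr b') (Sum A B)
| eq_SumInd G A B C C' c c' d d' s s' :
    is_type K G A -> is_type K G B ->
    is_type K (Sum A B :: G) C -> eq_type K (Sum A B :: G) C C' ->
    eq_term K (A :: G) c c' (inst_over 1 C (Inl (Var 0))) ->
    eq_term K (B :: G) d d' (inst_over 1 C (Inr (Var 0))) ->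
    eq_term K G s s' (Sum A B) ->
    eq_term K G (SumInd C c d s) (SumInd C' c' d' s') (inst C s)
| eq_BoolInd G C C' c0 c0' c1 c1' b b' :
    is_type K (Bool :: G) C -> eq_type K (Bool :: G) C C' ->
    eq_term K G c0 c0' (inst C B0) -> eq_term K G c1 c1' (inst C B1) ->
    eq_term K G b b' Bool ->
    eq_term K G (BoolInd C c0 c1 b) (BoolInd C' c0' c1' b') (inst C b)
| eq_Id G A A' a a' b b' :
    eq_term K G A A' U -> eq_term K G a a' A -> eq_term K G b b' A ->
    eq_term K G (Id A a b) (Id A' a' b') U
| eq_Refl G A a a' :
    is_type K G A -> eq_term K G a a' A ->
    eq_term K G (Refl a) (Refl a') (Id A a a)
| eq_J G A A' a a' C C' d d' b b' p p' :
    is_type K G A -> eq_type K G A A' ->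
    has_type K G a A -> eq_term K G a a' A ->
    is_type K (Id (shift A) (shift a) (Var 0) :: A :: G) C ->
    eq_type K (Id (shift A) (shift a) (Var 0) :: A :: G) C C' ->
    eq_term K G d d' (inst2 C a (Refl a)) ->
    eq_term K G b b' A -> eq_term K G p p' (Id A a b) ->
    eq_term K G (J A a C d b p) (J A' a' C' d' b' p') (inst2 C b p)
| eq_Trunc G A A' :
    eq_term K G A A' U -> eq_term K G (Trunc A) (Trunc A') U
| eq_Tr G A a a' :
    has_type K G A U -> eq_term K G a a' A ->
    eq_term K G (Tr a) (Tr a') (Trunc A)
| eq_TrProp G A A' :
    has_type K G A U -> eq_term K G A A' U ->
    eq_term K G (TrProp A) (TrProp A') (isProp (Trunc A))
| eq_TrRec G A A' P P' h h' f f' t t' :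
    has_type K G A U -> eq_term K G A A' U ->
    has_type K G P U -> eq_term K G P P' U ->
    eq_term K G h h' (isProp P) -> eq_term K G f f' (Arr A P) ->
    eq_term K G t t' (Trunc A) ->
    eq_term K G (TrRec A P h f t) (TrRec A' P' h' f' t') P
| eq_TrInd G A A' P P' h h' f f' t t' :
    K = RecAndInd ->
    has_type K G A U -> eq_term K G A A' U ->
    has_type K G P (Arr (Trunc A) U) -> eq_term K G P P' (Arr (Trunc A) U) ->
    eq_term K G h h' (Pi (Trunc A) (isProp (App (shift P) (Var 0)))) ->
    eq_term K G f f' (Pi A (App (shift P) (Tr (Var 0)))) ->
    eq_term K G t t' (Trunc A) ->
    eq_term K G (TrInd A P h f t) (TrInd A' P' h' f' t') (App P t).

(* h_{a,b} : a = b, for a, b : ||A|| *)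
Definition trunc_path (A a b : tm) : tm := App (App (TrProp A) a) b.

(* f : A -> B, p : Id A a b *)
Definition ap (A B f a b p : tm) : tm :=
  J A a
    (Id (shift2 B) (App (shift2 f) (shift2 a)) (App (shift2 f) (Var 1)))
    (Refl (App f a)) b p.

(* P : A -> U, p : Id A a b; the result is a function P a -> P b *)
Definition transport (A P a b p : tm) : tm :=
  J A a
    (Arr (App (shift2 P) (shift2 a)) (App (shift2 P) (Var 1)))
    (Lam (App P a) (Var 0)) b p.

(* P : A -> U, g : Pi x : A, P x, p : Id A a b *)
Definition apd (A P g a b p : tm) : tm :=
  J A a
    (Id (App (shift2 P) (Var 1))
        (App (transport (shift2 A) (shift2 P) (shift2 a) (Var 1) (Var 0))
             (App (shift2 g) (shift2 a)))
        (App (shift2 g) (Var 1)))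
    (Refl (App g a)) b p.

(* Main.v *)
(** The type of pairs (y, u) with u : c = y is a proposition, so the truncation
    may be eliminated into it.  Sending 0 to (y0, refl) and 1 to (y1, p) in
    Sigma y, y0 = y and projecting gives f, judgmentally correct at both
    endpoints; the second projection s z : y0 = f z agrees with ap_f along any
    path |0| = z by path induction, and at |1| it is p.

    For induction, the pairs are taken over a section c z = h_{|0|,z} *
    (h_{|0|,|0|}^-1 * a0) of P, which comes with a path e : a0 = c |0|.  For
    w : |0| = z, path induction gives a map (w * a0 = y) -> (c z = y), which at
    w = refl is k |-> e^-1 . k.  The endpoints are (a0, e^-1 . refl) and a1 with
    the image of q; path induction reduces apd_g w = k to left cancellation of
    e^-1.

    Judgmental equality is handled by deriving everything in small concrete
    contexts of variables, where terms compute and a syntactic checker finds all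
    conversion-free derivations, and by transferring the results with the
    substitution and functionality theorems. *)
From Stdlib Require Import List Bool.
Import ListNotations.
Require Import Defs.

(** * Substitution algebra *)

(** Since [Y] and the fibres of [P] need not be sets, a map with the right endpoints need not act on
    [h] as prescribed. The singleton carries the missing information: it is contractible whatever
    [Y] is, while its points (y0, refl) and (y1, p) record the endpoints and the path, and a
    homotopy from a constant map that starts at refl determines the action on paths completely. In
    the dependent case a section has to replace the constant map, and it meets a0 only up to the
    path e, because h_{|0|,|0|} is not judgmentally refl. The value a0 is judgmental all the same,
    being the first component of the pair chosen at |0|; e is confined to second components, and
    cancelling it there is the purpose of the path algebra.

    On the syntactic side, ap_f h lives in f |0| = f |1| but is compared with p in y0 = y1. Such
    types agree only by conversion, which the checker does not attempt, so facts that need it are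
    proved by hand over variables and then substituted. *)

Lemma up_ext (s s' : nat -> tm) :
  (forall n, s n = s' n) -> forall n, up s n = up s' n.
Proof. intros H [|n]; simpl; unfold shift; congruence. Qed.

(** Substitutions are compared pointwise throughout, so that function extensionality is not
    assumed. *)
Lemma subst_ext (t : tm) : forall s s',
  (forall n, s n = s' n) -> subst s t = subst s' t.
Proof. induction t; simpl; intros s s' H; f_equal; auto using up_ext. Qed.

Lemma up_up_ren (r : nat -> nat) n : up (fun m => Var (r m)) n = Var (up_ren r n).
Proof. destruct n; reflexivity. Qed.

(** Lets one stability theorem, stated for substitutions, cover renamings as well. *)
Lemma ren_as_subst (t : tm) : forall r, ren r t = subst (fun n => Var (r n)) t.
Proof.
  induction t; simpl; intros r; f_equal; auto;
    try (rewrite IHt || rewrite IHt1 || rewrite IHt2 || rewrite IHt3);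
    apply subst_ext; intros n; symmetry;
    try (rewrite (up_ext _ _ (up_up_ren r) n)); apply up_up_ren.
Qed.

(** The composition laws come in the order renaming then substitution, substitution then renaming,
    substitution twice: for [up], each later law needs the earlier ones. No constructor binds more
    than two variables, so [U1] and [U2] suffice. *)
Lemma subst_ren (t : tm) : forall r s, subst s (ren r t) = subst (fun n => s (r n)) t.
Proof.
  assert (U1 : forall r s n, up s (up_ren r n) = up (fun m => s (r m)) n)
    by (intros r s [|n]; reflexivity).
  assert (U2 : forall r s n,
             up (up s) (up_ren (up_ren r) n) = up (up (fun m => s (r m))) n).
  { intros r s n. rewrite U1. apply up_ext, U1. }
  induction t; simpl; intros r s; f_equal; auto;
    try (rewrite IHt || rewrite IHt1 || rewrite IHt2 || rewrite IHt3);
    apply subst_ext; auto.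
Qed.

Lemma ren_subst (t : tm) : forall r s, ren r (subst s t) = subst (fun n => ren r (s n)) t.
Proof.
  assert (U1 : forall r s n, ren (up_ren r) (up s n) = up (fun m => ren r (s m)) n).
  { intros r s [|n]; simpl; [reflexivity|]. unfold shift.
    rewrite (ren_as_subst (ren S (s n))), (ren_as_subst (ren r (s n))), !subst_ren. reflexivity. }
  assert (U2 : forall r s n,
             ren (up_ren (up_ren r)) (up (up s) n) = up (up (fun m => ren r (s m))) n).
  { intros r s n. rewrite U1. apply up_ext, U1. }
  induction t; simpl; intros r s; f_equal; auto;
    try (rewrite IHt || rewrite IHt1 || rewrite IHt2 || rewrite IHt3);
    apply subst_ext; auto.
Qed.

Lemma up_0 s : up s 0 = Var 0.
Proof. reflexivity. Qed.

Lemma up_1 s : up (up s) 1 = Var 1.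
Proof. reflexivity. Qed.

Lemma subst_up_shift (s : nat -> tm) t : subst (up s) (shift t) = shift (subst s t).
Proof. unfold shift. rewrite subst_ren, ren_subst. reflexivity. Qed.

Lemma subst_subst (t : tm) : forall s s',
  subst s' (subst s t) = subst (fun n => subst s' (s n)) t.
Proof.
  assert (U1 : forall s s' n, subst (up s') (up s n) = up (fun m => subst s' (s m)) n)
    by (intros s s' [|n]; simpl; [reflexivity | apply subst_up_shift]).
  assert (U2 : forall s s' n,
             subst (up (up s')) (up (up s) n) = up (up (fun m => subst s' (s m))) n).
  { intros s s' n. rewrite U1. apply up_ext, U1. }
  induction t; simpl; intros s s'; f_equal; auto;
    try (rewrite IHt || rewrite IHt1 || rewrite IHt2 || rewrite IHt3);
    apply subst_ext; auto.
Qed.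

Lemma subst_Var (t : tm) : subst Var t = t.
Proof.
  assert (U1 : forall n, up Var n = Var n) by (intros [|n]; reflexivity).
  assert (U2 : forall n, up (up Var) n = Var n)
    by (intros n; rewrite (up_ext _ _ U1); auto).
  assert (E1 : forall t, subst (up Var) t = subst Var t)
    by (intros; apply subst_ext, U1).
  assert (E2 : forall t, subst (up (up Var)) t = subst Var t)
    by (intros; apply subst_ext, U2).
  induction t; simpl; rewrite ?E1, ?E2; congruence.
Qed.

Lemma subst_scons_shift t s A : subst (scons t s) (shift A) = subst s A.
Proof. unfold shift. rewrite subst_ren. reflexivity. Qed.

Lemma inst_shift A a : inst (shift A) a = A.
Proof. unfold inst. rewrite subst_scons_shift. apply subst_Var. Qed.

Lemma shift_subst s A : shift (subst s A) = subst (fun n => shift (s n)) A.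
Proof. apply ren_subst. Qed.

Lemma shift_as_subst A : shift A = subst (fun n => Var (S n)) A.
Proof. apply ren_as_subst. Qed.

Lemma subst_inst s B a : subst s (inst B a) = inst (subst (up s) B) (subst s a).
Proof.
  unfold inst. rewrite !subst_subst. apply subst_ext. intros [|n]; simpl; auto.
  symmetry. apply inst_shift.
Qed.

Lemma subst_inst2 s C a b :
  subst s (inst2 C a b) = inst2 (subst (up (up s)) C) (subst s a) (subst s b).
Proof.
  unfold inst2. rewrite !subst_subst. apply subst_ext. intros [|[|n]]; simpl; auto.
  rewrite !subst_scons_shift. symmetry. apply subst_Var.
Qed.

Lemma subst_inst_over1 s C u :
  subst (up s) (inst_over 1 C u) = inst_over 1 (subst (up s) C) (subst (up s) u).
Proof.
  unfold inst_over. rewrite !subst_subst. apply subst_ext. intros [|n]; simpl; auto.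
  rewrite subst_scons_shift. apply shift_as_subst.
Qed.

Lemma subst_inst_over2 s C u :
  subst (up (up s)) (inst_over 2 C u)
  = inst_over 2 (subst (up s) C) (subst (up (up s)) u).
Proof.
  unfold inst_over. rewrite !subst_subst. apply subst_ext. intros [|n]; simpl; auto.
  rewrite subst_scons_shift. rewrite !shift_as_subst, subst_subst. reflexivity.
Qed.

Lemma subst_Arr s A B : subst s (Arr A B) = Arr (subst s A) (subst s B).
Proof. unfold Arr. simpl. rewrite subst_up_shift. reflexivity. Qed.

Lemma subst_isProp s A : subst s (isProp A) = isProp (subst s A).
Proof. unfold isProp, shift2. simpl. rewrite !subst_up_shift. reflexivity. Qed.

(** * Stability of the judgments *)

Scheme wf_ctx_mut := Minimality for wf_ctx Sort Prop
  with is_type_mut := Minimality for is_type Sort Prop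
  with has_type_mut := Minimality for has_type Sort Prop
  with eq_type_mut := Minimality for eq_type Sort Prop
  with eq_term_mut := Minimality for eq_term Sort Prop.
Combined Scheme judgment_ind
  from wf_ctx_mut, is_type_mut, has_type_mut, eq_type_mut, eq_term_mut.

Lemma judgment_wf (K : trunc_elim) :
  (forall G, wf_ctx K G -> wf_ctx K G) /\
  (forall G A, is_type K G A -> wf_ctx K G) /\
  (forall G t A, has_type K G t A -> wf_ctx K G) /\
  (forall G A B, eq_type K G A B -> wf_ctx K G) /\
  (forall G t u A, eq_term K G t u A -> wf_ctx K G).
Proof. apply judgment_ind; intros; auto using wf_nil, wf_cons. Qed.

Definition is_type_wf K := proj1 (proj2 (judgment_wf K)).
Definition has_type_wf K := proj1 (proj2 (proj2 (judgment_wf K))).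

(* A class of substitutions closed under weakening and under going below a
   binder.  Renamings form such a class, and their stability is what shows that
   all well-typed substitutions do. *)
Record subst_class (K : trunc_elim) (R : ctx -> (nat -> tm) -> ctx -> Prop) : Prop := {
  class_var : forall D s G n A, wf_ctx K D -> R D s G -> lookup G n A ->
    has_type K D (s n) (subst s A);
  class_weaken : forall D s G B, wf_ctx K D -> R D s G -> is_type K D B ->
    R (B :: D) (fun n => shift (s n)) G;
  class_up : forall D s G A, wf_ctx K D -> R D s G -> is_type K D (subst s A) ->
    R (subst s A :: D) (up s) (A :: G) }.

Lemma stable (K : trunc_elim) R (HR : subst_class K R) :
  (forall G, wf_ctx K G -> True) /\
  (forall G A, is_type K G A -> forall D s, wf_ctx K D -> R D s G ->
     is_type K D (subst s A)) /\
  (forall G t A, has_type K G t A -> forall D s, wf_ctx K D -> R D s G ->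
     has_type K D (subst s t) (subst s A)) /\
  (forall G A B, eq_type K G A B -> forall D s, wf_ctx K D -> R D s G ->
     eq_type K D (subst s A) (subst s B)) /\
  (forall G t u A, eq_term K G t u A -> forall D s, wf_ctx K D -> R D s G ->
     eq_term K D (subst s t) (subst s u) (subst s A)).
Proof.
  destruct HR as [Hvar Hweak Hup].
  assert (Hwf : forall D s A, wf_ctx K D -> is_type K D (subst s A) ->
                  wf_ctx K (subst s A :: D)) by (intros; constructor; auto).
  (* The [J] rules have no premise saying that the identity type in the context of the motive is
     well formed, so no induction hypothesis covers it; it is rebuilt from those for [A] and [a]. *)
  assert (HId : forall G A a,
    (forall D s, wf_ctx K D -> R D s G -> is_type K D (subst s A)) ->
    (forall D s, wf_ctx K D -> R D s G -> has_type K D (subst s a) (subst s A)) ->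
    forall D s, wf_ctx K D -> R D s G ->
      is_type K (subst s A :: D) (subst (up s) (Id (shift A) (shift a) (Var 0)))).
  { intros G A a IHA IHa D s HD HR. cbn [subst]. rewrite !subst_up_shift, !shift_subst.
    assert (HA : is_type K D (subst s A)) by auto.
    assert (HW := Hweak _ _ _ _ HD HR HA).
    apply ty_Id; auto. apply tm_Var; auto. change (up s 0) with (Var 0).
    rewrite <- shift_subst. constructor. }
  apply judgment_ind; try (intros; exact I);
    lazymatch goal with
    | |- forall (G : ctx) (n : nat) (A : tm), wf_ctx _ _ -> _ => intros; apply Hvar with G; auto
    | _ => intros
    end;
    repeat match goal with
    | IHA : forall D s, wf_ctx _ D -> R D s ?G -> is_type K D (subst s ?A),
      IHa : forall D s, wf_ctx _ D -> R D s ?G -> has_type K D (subst s ?a) (subst s ?A),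
      HD : wf_ctx K ?D, HR : R ?D ?s ?G,
      _ : context [Id (shift ?A) (shift ?a) (Var 0) :: ?A :: ?G] |- _ =>
        lazymatch goal with
        | _ : is_type K (subst s A :: D) (subst (up s) (Id (shift A) (shift a) (Var 0))) |- _ =>
            fail
        | _ => pose proof (HId G A a IHA IHa D s HD HR)
        end
    end;
    match goal with
    | HD : wf_ctx K ?D, HR : R ?D ?s ?G |- _ =>
      repeat match goal with
      | IH : forall D s, wf_ctx _ D -> R D s G -> _ |- _ => specialize (IH D s HD HR)
      end;
      (* A hypothesis below a binder becomes usable once the substituted bound type is known to be
         well formed. *)
      repeat match goal with
      | IH : forall D s, wf_ctx _ D -> R D s (?A :: G) -> _ |- _ =>
          let HA := fresh "HA" in
          assert (HA : is_type K D (subst s A))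
            by (cbn [subst] in *; auto using ty_small, ty_Sig, ty_Sum, tm_Bool, tm_Trunc);
          specialize (IH _ (up s) (Hwf _ _ _ HD HA) (Hup _ _ _ _ HD HR HA))
      | IH : forall D s, wf_ctx _ D -> R D s (?B :: ?A :: G) -> _ |- _ =>
          let HA := fresh "HA" in
          assert (HA : is_type K D (subst s A)) by (auto using ty_small);
          let HB := fresh "HB" in
          assert (HB : is_type K (subst s A :: D) (subst (up s) B)) by auto;
          let HD' := constr:(Hwf _ _ _ HD HA) in
          let HR' := constr:(Hup _ _ _ _ HD HR HA) in
          specialize (IH _ (up (up s)) (Hwf _ _ _ HD' HB) (Hup _ _ _ _ HD' HR' HB))
      end
    end;
    cbn [subst] in *;
    repeat rewrite ?subst_inst, ?subst_inst2, ?subst_inst_over1, ?subst_inst_over2,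
      ?subst_Arr, ?subst_isProp, ?subst_up_shift in *;
    cbn [subst] in *; rewrite ?subst_up_shift, ?up_0, ?up_1 in *;
    eauto 2 using is_type, has_type, eq_type, eq_term.
Qed.

Lemma renaming_class (K : trunc_elim) :
  subst_class K (fun D s G => exists r, (forall n, s n = Var (r n)) /\
    forall n A, lookup G n A -> lookup D (r n) (subst s A)).
Proof.
  split.
  - intros D s G n A HD [r [Hs Hr]] Hn. rewrite Hs. apply tm_Var; auto.
  - intros D s G B HD [r [Hs Hr]] HB. exists (fun n => S (r n)). split.
    + intros n. rewrite Hs. reflexivity.
    + intros n A Hn. rewrite <- shift_subst. constructor. auto.
  - intros D s G A HD [r [Hs Hr]] HA. exists (up_ren r). split.
    + intros [|n]; simpl; [|rewrite Hs]; reflexivity.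
    + intros n B Hn. inversion Hn; subst; rewrite subst_up_shift; constructor; auto.
Qed.

Lemma lookup_S_weaken B G n A :
  lookup G n A -> lookup (B :: G) (S n) (subst (fun n => Var (S n)) A).
Proof. intros H. rewrite <- shift_as_subst. constructor. exact H. Qed.

Lemma weaken_type K G A B : is_type K G A -> is_type K G B -> is_type K (B :: G) (shift A).
Proof.
  intros HA HB. rewrite shift_as_subst.
  assert (wf_ctx K G) by eauto using is_type_wf.
  apply (proj1 (proj2 (stable K _ (renaming_class K))) G A HA); [constructor; auto|].
  exists S. auto using lookup_S_weaken.
Qed.

Lemma weaken_term K G t A B :
  has_type K G t A -> is_type K G B -> has_type K (B :: G) (shift t) (shift A).
Proof.
  intros Ht HB. rewrite !shift_as_subst.
  assert (wf_ctx K G) by eauto using is_type_wf.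
  apply (proj1 (proj2 (proj2 (stable K _ (renaming_class K)))) G t A Ht); [constructor; auto|].
  exists S. auto using lookup_S_weaken.
Qed.

(** * Well-typed substitutions *)

Definition subst_ok (K : trunc_elim) (D : ctx) (s : nat -> tm) (G : ctx) : Prop :=
  forall n A, lookup G n A -> has_type K D (s n) (subst s A).

Lemma subst_ok_nil K D s : subst_ok K D s [].
Proof. intros n A H. inversion H. Qed.

Lemma subst_ok_cons K D s G t A :
  subst_ok K D s G -> has_type K D t (subst s A) -> subst_ok K D (scons t s) (A :: G).
Proof.
  intros Hs Ht n B Hn. inversion Hn; subst; rewrite subst_scons_shift; simpl; auto.
Qed.

Lemma subst_ok_class (K : trunc_elim) : subst_class K (subst_ok K).
Proof.
  split.
  - intros D s G n A _ Hs Hn. auto.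
  - intros D s G B _ Hs HB n A Hn. rewrite <- shift_subst. apply weaken_term; auto.
  - intros D s G A HD Hs HA n B Hn.
    assert (wf_ctx K (subst s A :: D)) by (constructor; auto).
    inversion Hn; subst; rewrite subst_up_shift; simpl.
    + apply tm_Var; [auto | constructor].
    + apply weaken_term; auto.
Qed.

Lemma subst_type K G A D s :
  is_type K G A -> wf_ctx K D -> subst_ok K D s G -> is_type K D (subst s A).
Proof. intros; eapply (stable K _ (subst_ok_class K)); eassumption. Qed.

Lemma subst_term K G t A D s :
  has_type K G t A -> wf_ctx K D -> subst_ok K D s G -> has_type K D (subst s t) (subst s A).
Proof. intros; eapply (stable K _ (subst_ok_class K)); eassumption. Qed.

Lemma subst_eq_term K G t u A D s :
  eq_term K G t u A -> wf_ctx K D -> subst_ok K D s G ->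
  eq_term K D (subst s t) (subst s u) (subst s A).
Proof. intros; eapply (stable K _ (subst_ok_class K)); eassumption. Qed.

Lemma subst_ok_Var K G : wf_ctx K G -> subst_ok K G Var G.
Proof. intros HG n A Hn. rewrite subst_Var. apply tm_Var; auto. Qed.

Lemma inst_type K G A B a :
  is_type K (A :: G) B -> has_type K G a A -> is_type K G (inst B a).
Proof.
  intros HB Ha. assert (HG := has_type_wf _ _ _ _ Ha).
  apply subst_type with (1 := HB); auto.
  apply subst_ok_cons; [apply subst_ok_Var; auto | rewrite subst_Var; auto].
Qed.

Lemma weaken_eq_term K G t u A B :
  eq_term K G t u A -> is_type K G B -> eq_term K (B :: G) (shift t) (shift u) (shift A).
Proof.
  intros E HB. rewrite !shift_as_subst.
  assert (wf_ctx K G) by eauto using is_type_wf.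
  apply (proj2 (proj2 (proj2 (proj2 (stable K _ (renaming_class K))))) G t u A E);
    [constructor; auto|].
  exists S. auto using lookup_S_weaken.
Qed.

(** * Functionality under judgmentally equal substitutions *)

Definition subst_eq (K : trunc_elim) (D : ctx) (s s' : nat -> tm) (G : ctx) : Prop :=
  forall n A, lookup G n A -> eq_term K D (s n) (s' n) (subst s A).

Lemma subst_eq_up K D s s' G A :
  subst_eq K D s s' G -> is_type K D (subst s A) ->
  subst_eq K (subst s A :: D) (up s) (up s') (A :: G).
Proof.
  intros E HA n B Hn.
  assert (wf_ctx K (subst s A :: D)) by eauto using wf_cons, is_type_wf.
  inversion Hn; subst; rewrite subst_up_shift; simpl.
  - apply eq_tm_refl, tm_Var; [auto | constructor].
  - apply weaken_eq_term; auto.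
Qed.

(** Lets a judgmental equality be used anywhere inside a term at once, in place of a chain of
    congruence rules. Those rules have typing premises on their left-hand sides, so typing of the
    first instance is carried through the induction. Stability of type equality is included for the
    conversion rule. *)
Lemma functional (K : trunc_elim) :
  (forall G, wf_ctx K G -> True) /\
  (forall G A, is_type K G A -> forall D s s', wf_ctx K D -> subst_ok K D s G ->
     subst_eq K D s s' G -> is_type K D (subst s A) /\ eq_type K D (subst s A) (subst s' A)) /\
  (forall G t A, has_type K G t A -> forall D s s', wf_ctx K D -> subst_ok K D s G ->
     subst_eq K D s s' G -> has_type K D (subst s t) (subst s A) /\
     eq_term K D (subst s t) (subst s' t) (subst s A)) /\
  (forall G A B, eq_type K G A B -> forall D s, wf_ctx K D -> subst_ok K D s G ->
     eq_type K D (subst s A) (subst s B)) /\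
  (forall G t u A, eq_term K G t u A -> True).
Proof.
  assert (Hwf : forall D s A, wf_ctx K D -> is_type K D (subst s A) ->
                  wf_ctx K (subst s A :: D)) by (intros; constructor; auto).
  assert (Hup : forall D s G A, wf_ctx K D -> subst_ok K D s G -> is_type K D (subst s A) ->
                  subst_ok K (subst s A :: D) (up s) (A :: G))
    by (intros; apply (class_up _ _ (subst_ok_class K)); auto).
  apply judgment_ind; try (intros; exact I);
    try (intros; eapply (stable K _ (subst_ok_class K)); eauto using eq_type; fail);
    try (intros G n A _ _ Hn D s s' HD Hs E; split; [apply Hs | apply E]; assumption);
    intros;
    match goal with
    | HD : wf_ctx K ?D, HR : subst_ok K ?D ?s ?G, HE : subst_eq K ?D ?s ?s' ?G |- _ =>
      repeat match goal with
      | IH : forall D s s', wf_ctx _ D -> subst_ok _ D s G -> _ |- _ =>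
          specialize (IH D s s' HD HR HE); destruct IH
      | IH : forall D s, wf_ctx _ D -> subst_ok _ D s G -> _ |- _ =>
          specialize (IH D s HD HR)
      end;
      try match goal with
      | HA : is_type K D (subst s ?A), Ha : has_type K D (subst s ?a) (subst s ?A),
        _ : context [Id (shift ?A) (shift ?a) (Var 0) :: ?A :: G] |- _ =>
          assert (is_type K (subst s A :: D) (subst (up s) (Id (shift A) (shift a) (Var 0))))
            by (cbn [subst]; rewrite !subst_up_shift; apply ty_Id;
                [apply weaken_type | apply weaken_term | apply tm_Var; [|apply lookup_here]];
                auto)
      end;
      repeat match goal with
      | IH : forall D s s', wf_ctx _ D -> subst_ok _ D s (?A :: G) -> _ |- _ =>
          let HA := fresh "HA" in
          assert (HA : is_type K D (subst s A))
            by (cbn [subst] in *; auto using ty_small, ty_Sig, ty_Sum, tm_Bool, tm_Trunc);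
          specialize (IH _ (up s) (up s') (Hwf _ _ _ HD HA) (Hup _ _ _ _ HD HR HA)
                        (subst_eq_up _ _ _ _ _ _ HE HA)); destruct IH
      | IH : forall D s s', wf_ctx _ D -> subst_ok _ D s (?B :: ?A :: G) -> _ |- _ =>
          let HA := fresh "HA" in
          assert (HA : is_type K D (subst s A)) by (auto using ty_small);
          let HB := fresh "HB" in
          assert (HB : is_type K (subst s A :: D) (subst (up s) B)) by auto;
          let HD' := constr:(Hwf _ _ _ HD HA) in
          let HR' := constr:(Hup _ _ _ _ HD HR HA) in
          let HE' := constr:(subst_eq_up _ _ _ _ _ _ HE HA) in
          specialize (IH _ (up (up s)) (up (up s')) (Hwf _ _ _ HD' HB) (Hup _ _ _ _ HD' HR' HB)
                        (subst_eq_up _ _ _ _ _ _ HE' HB)); destruct IH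
      end
    end;
    cbn [subst] in *;
    repeat rewrite ?subst_inst, ?subst_inst2, ?subst_inst_over1, ?subst_inst_over2,
      ?subst_Arr, ?subst_isProp, ?subst_up_shift in *;
    cbn [subst] in *; rewrite ?subst_up_shift, ?up_0, ?up_1 in *;
    split; eauto 3 using is_type, has_type, eq_type, eq_term.
Qed.

Lemma subst_eq_nil K D s s' : subst_eq K D s s' [].
Proof. intros n A H. inversion H. Qed.

Lemma subst_eq_cons K D s s' G t t' A :
  subst_eq K D s s' G -> eq_term K D t t' (subst s A) ->
  subst_eq K D (scons t s) (scons t' s') (A :: G).
Proof.
  intros Hs Ht n B Hn. inversion Hn; subst; rewrite subst_scons_shift; simpl; auto.
Qed.

Lemma functional_type K G A D s s' :
  is_type K G A -> wf_ctx K D -> subst_ok K D s G -> subst_eq K D s s' G ->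
  eq_type K D (subst s A) (subst s' A).
Proof. intros HA HD Hs E. exact (proj2 (proj1 (proj2 (functional K)) _ _ HA _ _ _ HD Hs E)). Qed.

Lemma functional_term K G t A D s s' :
  has_type K G t A -> wf_ctx K D -> subst_ok K D s G -> subst_eq K D s s' G ->
  eq_term K D (subst s t) (subst s' t) (subst s A).
Proof.
  intros Ht HD Hs E. exact (proj2 (proj1 (proj2 (proj2 (functional K))) _ _ _ Ht _ _ _ HD Hs E)).
Qed.

(** * A checker for derivations without conversion *)

Lemma tm_eq_dec (t u : tm) : {t = u} + {t <> u}.
Proof. decide equality; decide equality. Defined.

Definition tm_eqb (t u : tm) : bool := if tm_eq_dec t u then true else false.

Lemma tm_eqb_eq t u : tm_eqb t u = true -> t = u.
Proof. unfold tm_eqb. destruct (tm_eq_dec t u); congruence. Qed.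

(** A product is a type either by formation or, the universe being a la Russell, as an element of
    [U]. In the second case the typing derivation may end in conversions, hence the induction on
    it. *)
Lemma Pi_type_inv K G A B : is_type K G (Pi A B) -> is_type K G A /\ is_type K (A :: G) B.
Proof.
  intros H. inversion H as [|? ? Ht| | | |]; subst; auto.
  remember (Pi A B) as t eqn:E in Ht. clear H.
  induction Ht; inversion E; subst; auto using ty_small.
Qed.

Lemma App_type K G A B f a :
  has_type K G f (Pi A B) -> is_type K G (Pi A B) -> has_type K G a A ->
  has_type K G (App f a) (inst B a).
Proof. intros Hf HAB Ha. apply Pi_type_inv in HAB as [? ?]. eapply tm_App; eauto. Qed.

Lemma Sig_type_inv K G A B : is_type K G (Sig A B) -> is_type K G A /\ is_type K (A :: G) B.
Proof.
  intros H. inversion H as [|? ? Ht| | | |]; subst; auto.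
  remember (Sig A B) as t eqn:E in Ht. clear H.
  induction Ht; inversion E; subst; auto using ty_small.
Qed.

Lemma Id_type_inv K G A a b :
  is_type K G (Id A a b) -> is_type K G A /\ has_type K G a A /\ has_type K G b A.
Proof.
  intros H. inversion H as [|? ? Ht| | | |]; subst; auto.
  remember (Id A a b) as t eqn:E in Ht. clear H.
  induction Ht; inversion E; subst; auto using ty_small.
Qed.

Lemma Trunc_type_inv K G A : is_type K G (Trunc A) -> has_type K G A U.
Proof.
  intros H. inversion H as [|? ? Ht| | | |]; subst.
  assert (Hgen : forall t T, has_type K G t T -> t = Trunc A -> has_type K G A U).
  { clear. intros t T Ht. induction Ht; intros E; inversion E; subst; auto. }
  eauto.
Qed.

Lemma isProp_type K G A : is_type K G A -> is_type K G (isProp A).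
Proof.
  intros HA. assert (HG := is_type_wf _ _ _ HA).
  assert (HA1 := weaken_type _ _ _ _ HA HA).
  assert (HA2 := weaken_type _ _ _ _ HA1 HA1).
  assert (wf_ctx K (shift A :: A :: G)) by auto using wf_cons.
  apply ty_Pi; auto. apply ty_Pi; auto. apply ty_Id; auto; apply tm_Var; auto.
  - apply lookup_there, lookup_here.
  - apply lookup_here.
Qed.

Fixpoint lookup_fun (G : ctx) (n : nat) : option tm :=
  match G, n with
  | A :: _, 0 => Some (shift A)
  | _ :: G, S n => option_map shift (lookup_fun G n)
  | [], _ => None
  end.

Lemma lookup_fun_sound G : forall n A, lookup_fun G n = Some A -> lookup G n A.
Proof.
  induction G as [|B G IH]; intros [|n] A H; simpl in H; try discriminate.
  - injection H as <-. constructor.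
  - destruct (lookup_fun G n) eqn:E; [|discriminate]. injection H as <-.
    constructor; auto.
Qed.

Lemma lookup_type K G n A : wf_ctx K G -> lookup G n A -> is_type K G A.
Proof. intros HG Hn. induction Hn; inversion HG; subst; auto using weaken_type. Qed.

(** [IsType] is separate because large types, such as [U] or a type of families, belong to no
    universe against which they could be checked. *)
Inductive mode : Type := Infer | Check (A : tm) | IsType.

Definition guard (b : bool) (A : tm) : option tm := if b then Some A else None.
Definition accepts (o : option tm) : bool := if o then true else false.

Definition has_ind (K : trunc_elim) : bool :=
  match K with RecOnly => false | RecAndInd => true end.

(* [Pair] and [Tr] carry no type annotation, so they are only checked against a
   given type, never inferred. *)
Fixpoint tc (K : trunc_elim) (G : ctx) (t : tm) (m : mode) {struct t} : option tm :=
  let inferred :=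
    match t with
    | Var n => lookup_fun G n
    | Pi A B | Sig A B =>
        guard (accepts (tc K G A (Check U)) && accepts (tc K (A :: G) B (Check U))) U
    | Lam A b =>
        if accepts (tc K G A IsType) then
          option_map (Pi A) (tc K (A :: G) b Infer)
        else None
    | App f a =>
        match tc K G f Infer with
        | Some (Pi A B) => guard (accepts (tc K G a (Check A))) (inst B a)
        | _ => None
        end
    | SigInd C d p =>
        match tc K G p Infer with
        | Some (Sig A B) =>
            guard (accepts (tc K (Sig A B :: G) C IsType) &&
                   accepts (tc K (B :: A :: G) d
                              (Check (inst_over 2 C (Pair (Var 1) (Var 0))))))
                  (inst C p)
        | _ => None
        end
    | Bool => Some U
    | B0 | B1 => Some Bool
    | BoolInd C c0 c1 b =>
        guard (accepts (tc K (Bool :: G) C IsType) &&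
               accepts (tc K G c0 (Check (inst C B0))) &&
               accepts (tc K G c1 (Check (inst C B1))) &&
               accepts (tc K G b (Check Bool))) (inst C b)
    | Id A a b =>
        guard (accepts (tc K G A (Check U)) && accepts (tc K G a (Check A)) &&
               accepts (tc K G b (Check A))) U
    | Refl a => option_map (fun A => Id A a a) (tc K G a Infer)
    | J A a C d b p =>
        guard (accepts (tc K G A IsType) && accepts (tc K G a (Check A)) &&
               accepts (tc K (Id (shift A) (shift a) (Var 0) :: A :: G) C IsType) &&
               accepts (tc K G d (Check (inst2 C a (Refl a)))) &&
               accepts (tc K G b (Check A)) && accepts (tc K G p (Check (Id A a b))))
              (inst2 C b p)
    | Trunc A => guard (accepts (tc K G A (Check U))) U
    | TrProp A => guard (accepts (tc K G A (Check U))) (isProp (Trunc A))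
    | TrRec A P h f t =>
        guard (accepts (tc K G A (Check U)) && accepts (tc K G P (Check U)) &&
               accepts (tc K G h (Check (isProp P))) &&
               accepts (tc K G f (Check (Arr A P))) &&
               accepts (tc K G t (Check (Trunc A)))) P
    | TrInd A P h f t =>
        guard (has_ind K && accepts (tc K G A (Check U)) &&
               accepts (tc K G P (Check (Arr (Trunc A) U))) &&
               accepts (tc K G h (Check (Pi (Trunc A) (isProp (App (shift P) (Var 0)))))) &&
               accepts (tc K G f (Check (Pi A (App (shift P) (Tr (Var 0)))))) &&
               accepts (tc K G t (Check (Trunc A)))) (App P t)
    | _ => None
    end in
  match m with
  | Infer => inferred
  | Check T =>
      match t, T with
      | Pair a b, Sig A B =>
          guard (accepts (tc K G a (Check A)) && accepts (tc K G b (Check (inst B a)))) T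
      | Lam A b, Pi A' B =>
          guard (tm_eqb A A' && accepts (tc K (A :: G) b (Check B))) T
      | Refl a, Id A a1 a2 =>
          guard (tm_eqb a a1 && tm_eqb a a2 && accepts (tc K G a (Check A))) T
      | Tr a, Trunc A => guard (accepts (tc K G a (Check A))) T
      | _, _ =>
          match inferred with Some T' => guard (tm_eqb T' T) T | None => None end
      end
  | IsType =>
      match t with
      | U => Some U
      | Pi A B | Sig A B =>
          guard (accepts (tc K G A IsType) && accepts (tc K (A :: G) B IsType)) U
      | Id A a b =>
          guard (accepts (tc K G A IsType) && accepts (tc K G a (Check A)) &&
                 accepts (tc K G b (Check A))) U
      | _ => match inferred with Some U => Some U | _ => None end
      end
  end.

Definition mode_ok (K : trunc_elim) (G : ctx) (m : mode) : Prop :=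
  match m with Check A => is_type K G A | _ => True end.

Definition tc_spec (K : trunc_elim) (G : ctx) (t : tm) (m : mode) (T : tm) : Prop :=
  match m with
  | Infer => has_type K G t T /\ is_type K G T
  | Check A => has_type K G t A
  | IsType => is_type K G t
  end.

Definition tc_sound_at (t : tm) : Prop := forall K G m T,
  wf_ctx K G -> mode_ok K G m -> tc K G t m = Some T -> tc_spec K G t m T.

Lemma tc_sound_accepts t K G m :
  tc_sound_at t -> accepts (tc K G t m) = true -> wf_ctx K G -> mode_ok K G m ->
  exists T, tc_spec K G t m T.
Proof.
  intros Ht E HG Hm. destruct (tc K G t m) as [T|] eqn:Et; [|discriminate].
  exists T. eapply Ht; eauto.
Qed.

Lemma sound_check t K G A :
  tc_sound_at t -> accepts (tc K G t (Check A)) = true -> is_type K G A -> has_type K G t A.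
Proof.
  intros Ht E HA. edestruct tc_sound_accepts as [T HT];
    [exact Ht | exact E | eauto using is_type_wf | exact HA | exact HT].
Qed.

Lemma sound_istype t K G :
  tc_sound_at t -> accepts (tc K G t IsType) = true -> wf_ctx K G -> is_type K G t.
Proof.
  intros Ht E HG. edestruct tc_sound_accepts as [T HT];
    [exact Ht | exact E | exact HG | exact I | exact HT].
Qed.

Lemma guard_Some b A T : guard b A = Some T -> b = true /\ T = A.
Proof. destruct b; simpl; [intros [= <-]; auto | discriminate]. Qed.

(** Soundness of checking presupposes that the expected type is well formed; this provides it for
    the branch of a [SigInd]. The next lemmas do the same for [J], arrows and families. *)
Lemma over_Pair_type K G A B C :
  is_type K G A -> is_type K (A :: G) B -> is_type K (Sig A B :: G) C ->
  is_type K (B :: A :: G) (inst_over 2 C (Pair (Var 1) (Var 0))).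
Proof.
  intros HA HB HC.
  assert (wf_ctx K (B :: A :: G)) by eauto using wf_cons, is_type_wf.
  assert (HS : is_type K G (Sig A B)) by (apply ty_Sig; auto).
  assert (Hs : subst_ok K (B :: A :: G) (fun n => Var (2 + n)) G).
  { intros n T Hn. apply tm_Var; auto.
    replace (subst (fun n => Var (2 + n)) T) with (shift (shift T)).
    - repeat constructor; auto.
    - rewrite !shift_as_subst, subst_subst. reflexivity. }
  unfold inst_over. apply subst_type with (1 := HC); auto.
  apply subst_ok_cons; auto. cbn [subst].
  assert (HA' : is_type K (B :: A :: G) (subst (fun n => Var (2 + n)) A))
    by (apply subst_type with G; auto).
  assert (HV : has_type K (B :: A :: G) (Var 1) (subst (fun n => Var (2 + n)) A)).
  { apply tm_Var; auto.
    replace (subst (fun n => Var (2 + n)) A) with (shift (shift A)).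
    - repeat constructor.
    - rewrite !shift_as_subst, subst_subst. reflexivity. }
  apply tm_Pair; auto.
  - apply subst_type with (A :: G); auto.
    + constructor; auto.
    + apply (class_up _ _ (subst_ok_class K)); auto.
  - apply tm_Var; auto.
    replace (inst (subst (up (fun n => Var (2 + n))) B) (Var 1)) with (shift B).
    + constructor.
    + unfold inst. rewrite shift_as_subst, subst_subst. apply subst_ext.
      intros [|n]; reflexivity.
Qed.

Lemma inst2_type K G A a C b p :
  is_type K G A -> has_type K G a A ->
  is_type K (Id (shift A) (shift a) (Var 0) :: A :: G) C ->
  has_type K G b A -> has_type K G p (Id A a b) -> is_type K G (inst2 C b p).
Proof.
  intros HA Ha HC Hb Hp. assert (HG := is_type_wf _ _ _ HA).
  apply subst_type with (1 := HC); auto.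
  apply subst_ok_cons; [apply subst_ok_cons; [apply subst_ok_Var; auto|]|].
  - rewrite subst_Var. auto.
  - cbn [subst]. rewrite !subst_scons_shift, !subst_Var. auto.
Qed.

Lemma J_motive_ctx_wf K G A a :
  is_type K G A -> has_type K G a A -> wf_ctx K (Id (shift A) (shift a) (Var 0) :: A :: G).
Proof.
  intros HA Ha. assert (wf_ctx K (A :: G)) by (constructor; eauto using is_type_wf).
  constructor; auto. apply ty_Id; auto using weaken_type, weaken_term.
  apply tm_Var; auto. constructor.
Qed.

Lemma Arr_type K G A B : is_type K G A -> is_type K G B -> is_type K G (Arr A B).
Proof. intros. apply ty_Pi; auto using weaken_type. Qed.

Lemma family_App K G A P t :
  has_type K G A U -> has_type K G P (Arr A U) -> has_type K G t A -> has_type K G (App P t) U.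
Proof.
  intros HA HP Ht. assert (HG := has_type_wf _ _ _ _ HA).
  change U with (inst U t). apply tm_App with A; auto using ty_small.
  apply ty_U. constructor; auto using ty_small.
Qed.

Ltac tc_split :=
  repeat match goal with
  | H : guard _ _ = Some _ |- _ => apply guard_Some in H; destruct H as [H ->]
  | H : _ && _ = true |- _ => apply andb_prop in H; destruct H
  | H : tm_eqb _ _ = true |- _ => apply tm_eqb_eq in H; subst
  end.

Lemma infer_check t K G A T :
  (tc K G t Infer = Some A -> has_type K G t A) ->
  match tc K G t Infer with Some T' => guard (tm_eqb T' A) A | None => None end = Some T ->
  has_type K G t A.
Proof.
  intros H E. destruct (tc K G t Infer) as [T'|]; [|discriminate].
  tc_split. auto.
Qed.

Lemma infer_istype t K G T :
  (tc K G t Infer = Some U -> has_type K G t U) ->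
  match tc K G t Infer with Some U => Some U | _ => None end = Some T ->
  is_type K G t.
Proof.
  intros H E. destruct (tc K G t Infer) as [[]|]; try discriminate.
  apply ty_small. auto.
Qed.

Ltac use_sound tac :=
  repeat match goal with
  | IH : tc_sound_at ?t, H : accepts (tc ?K ?G ?t (Check ?A)) = true |- _ =>
      apply (sound_check t K G A IH) in H; [|solve [tac]]
  | IH : tc_sound_at ?t, H : accepts (tc ?K ?G ?t IsType) = true |- _ =>
      apply (sound_istype t K G IH) in H; [|solve [tac]]
  end.

Lemma tc_sound (t : tm) : tc_sound_at t.
Proof.
  induction t;
    match goal with |- tc_sound_at ?t =>
      (* Checking and type formation fall back on inference for the same term, which no induction
         hypothesis covers, so inference is settled first. *)
      assert (Hinf : forall K G, wf_ctx K G -> forall T, tc K G t Infer = Some T ->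
                has_type K G t T /\ is_type K G T);
      [ intros K G HG T E; try discriminate E; cbn [tc] in E; tc_split
      | intros K G [|A|] T HG Hm E; cbn [tc_spec mode_ok] in *;
        [ exact (Hinf K G HG T E) | | ];
        specialize (Hinf K G HG);
        try solve [apply (infer_check _ K G A T (fun E => proj1 (Hinf _ E))); exact E
                  |apply (infer_istype _ K G T (fun E => proj1 (Hinf _ E))); exact E] ]
    end.
  - split; [apply tm_Var|apply lookup_type with n]; auto using lookup_fun_sound.
  - apply ty_U; auto.
  - use_sound ltac:(eauto using ty_U, wf_cons, ty_small). auto using ty_U, tm_Pi.
  - cbn [tc] in E. tc_split. use_sound ltac:(eauto using wf_cons). auto using ty_Pi.
  - destruct (accepts (tc K G t1 IsType)) eqn:E1; [|discriminate].
    use_sound ltac:(auto).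
    destruct (tc K (t1 :: G) t2 Infer) as [B|] eqn:E2; [|discriminate].
    injection E as <-. apply IHt2 in E2 as [? ?]; [|auto using wf_cons|exact I].
    auto using tm_Lam, ty_Pi.
  - destruct A; try (apply (infer_check _ K G _ T (fun E => proj1 (Hinf _ E))); exact E).
    cbn [tc] in E. tc_split. apply Pi_type_inv in Hm as [? ?].
    use_sound ltac:(auto). auto using tm_Lam.
  - destruct (tc K G t1 Infer) as [[]|] eqn:E1; try discriminate.
    tc_split. apply IHt1 in E1 as [? HT]; auto; [|exact I].
    apply Pi_type_inv in HT as [? ?]. use_sound ltac:(auto).
    eauto using tm_App, inst_type.
  - use_sound ltac:(eauto using ty_U, wf_cons, ty_small). auto using ty_U, tm_Sig.
  - cbn [tc] in E. tc_split. use_sound ltac:(eauto using wf_cons). auto using ty_Sig.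
  - destruct A; cbn [tc] in E; try discriminate E.
    cbn [tc] in E. tc_split. apply Sig_type_inv in Hm as [? ?].
    use_sound ltac:(eauto using inst_type). auto using tm_Pair.
  - destruct (tc K G t3 Infer) as [[]|] eqn:E1; try discriminate.
    tc_split. apply IHt3 in E1 as [? HT]; auto; [|exact I].
    assert (HS := HT). apply Sig_type_inv in HT as [? ?].
    use_sound ltac:(eauto using over_Pair_type, wf_cons).
    eauto using tm_SigInd, inst_type.
  - injection E as <-. auto using tm_Bool, ty_U.
  - injection E as <-. auto using tm_Bool, tm_B0, ty_small.
  - injection E as <-. auto using tm_Bool, tm_B1, ty_small.
  - use_sound ltac:(eauto using inst_type, wf_cons, ty_small, tm_Bool, tm_B0, tm_B1).
    eauto using tm_BoolInd, inst_type.
  - use_sound ltac:(eauto using ty_U, ty_small). auto using ty_U, tm_Id.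
  - cbn [tc] in E. tc_split. use_sound ltac:(auto). auto using ty_Id.
  - destruct (tc K G t Infer) as [B|] eqn:E1; [|discriminate].
    injection E as <-. apply IHt in E1 as [? ?]; auto; [|exact I].
    auto using tm_Refl, ty_Id.
  - destruct A; try (apply (infer_check _ K G _ T (fun E => proj1 (Hinf _ E))); exact E).
    cbn [tc] in E. tc_split. apply Id_type_inv in Hm as [? [? ?]].
    auto using tm_Refl.
  - use_sound ltac:(eauto using inst2_type, J_motive_ctx_wf, ty_Id, tm_Refl).
    eauto using tm_J, inst2_type.
  - use_sound ltac:(eauto using ty_U). auto using ty_U, tm_Trunc.
  - destruct A; cbn [tc] in E; try discriminate E.
    cbn [tc] in E. tc_split. apply Trunc_type_inv in Hm.
    use_sound ltac:(auto using ty_small). auto using tm_Tr.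
  - use_sound ltac:(eauto using ty_U). auto using tm_TrProp, isProp_type, tm_Trunc, ty_small.
  - use_sound ltac:(auto using ty_U, ty_small, isProp_type, Arr_type, tm_Trunc).
    auto using tm_TrRec, ty_small.
  - assert (HK : K = RecAndInd) by (destruct K; [discriminate|reflexivity]).
    use_sound ltac:(auto using ty_U, ty_small, Arr_type, tm_Trunc).
    assert (HT : has_type K G (Trunc t1) U) by auto using tm_Trunc.
    (* The types expected of [h] and [f] apply the weakened family below a binder, over [Trunc t1]
       and over [t1] respectively; one statement serves both. *)
    assert (HF : forall X u, is_type K G X -> has_type K (X :: G) u (Trunc (shift t1)) ->
                   is_type K (X :: G) (App (shift t2) u)).
    { intros X u HX Hu. apply ty_small, family_App with (Trunc (shift t1)); auto.
      - exact (weaken_term _ _ _ _ _ HT HX).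
      - assert (HP := weaken_term _ _ _ _ _ H3 HX).
        rewrite (shift_as_subst (Arr _ _)), subst_Arr, <- !shift_as_subst in HP. exact HP. }
    assert (Hh : is_type K G (Pi (Trunc t1) (isProp (App (shift t2) (Var 0))))).
    { apply ty_Pi; auto using ty_small. apply isProp_type, HF; auto using ty_small.
      apply tm_Var; auto using wf_cons, ty_small. constructor. }
    assert (Hf : is_type K G (Pi t1 (App (shift t2) (Tr (Var 0))))).
    { apply ty_Pi; auto using ty_small. apply HF; auto using ty_small.
      apply tm_Tr.
      - exact (weaken_term _ _ _ _ _ H4 (ty_small _ _ _ H4)).
      - apply tm_Var; auto using wf_cons, ty_small. constructor. }
    use_sound ltac:(auto).
    split; [apply tm_TrInd; auto | apply ty_small, family_App with (Trunc t1); auto].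
Qed.

Fixpoint tc_ctx (K : trunc_elim) (G : ctx) : bool :=
  match G with [] => true | A :: G => tc_ctx K G && accepts (tc K G A IsType) end.

Lemma tc_ctx_sound K G : tc_ctx K G = true -> wf_ctx K G.
Proof.
  induction G as [|A G IH]; intros E; simpl in E; [constructor|].
  apply andb_prop in E as [E1 E2]. constructor; auto.
  apply sound_istype; auto using tc_sound.
Qed.

Lemma tc_is_type K G A :
  tc_ctx K G && accepts (tc K G A IsType) = true -> is_type K G A.
Proof.
  intros E. apply andb_prop in E as [E1 E2].
  apply sound_istype; auto using tc_sound, tc_ctx_sound.
Qed.

Lemma tc_has_type K G t A :
  tc_ctx K G && accepts (tc K G A IsType) && accepts (tc K G t (Check A)) = true ->
  has_type K G t A.
Proof.
  intros E. apply andb_prop in E as [E1 E2].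
  apply sound_check; auto using tc_sound, tc_is_type.
Qed.

(** * Transfer between contexts *)

(** Proof by reflection. Contexts and terms are concrete, whereas [K] may stay a variable: only a
    [TrInd] makes the checker inspect it. *)
Ltac tc_auto :=
  lazymatch goal with
  | |- wf_ctx _ _ => apply tc_ctx_sound; vm_compute; reflexivity
  | |- is_type _ _ _ => apply tc_is_type; vm_compute; reflexivity
  | |- has_type _ _ _ _ => apply tc_has_type; vm_compute; reflexivity
  end.

(** As in contexts, the head belongs to the most recently declared variable. *)
Definition sub (l : list tm) : nat -> tm := fold_right scons Var l.

(** The equation lets a goal be matched with an instance by computation instead of unification. *)
Lemma use_subst_type K G A D l A' :
  is_type K G A -> wf_ctx K D -> subst_ok K D (sub l) G -> subst (sub l) A = A' ->
  is_type K D A'.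
Proof. intros; subst; eapply subst_type; eauto. Qed.

Lemma use_subst_term K G t A D l t' A' :
  has_type K G t A -> wf_ctx K D -> subst_ok K D (sub l) G ->
  subst (sub l) t = t' -> subst (sub l) A = A' -> has_type K D t' A'.
Proof. intros; subst; eapply subst_term; eauto. Qed.

Lemma use_subst_eq K G t u A D l t' u' A' :
  eq_term K G t u A -> wf_ctx K D -> subst_ok K D (sub l) G ->
  subst (sub l) t = t' -> subst (sub l) u = u' -> subst (sub l) A = A' ->
  eq_term K D t' u' A'.
Proof. intros; subst; eapply subst_eq_term; eauto. Qed.

Lemma use_cong_type K G A D l l' A1 A2 :
  is_type K G A -> wf_ctx K D -> subst_ok K D (sub l) G -> subst_eq K D (sub l) (sub l') G ->
  subst (sub l) A = A1 -> subst (sub l') A = A2 -> eq_type K D A1 A2.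
Proof. intros; subst; eapply functional_type; eauto. Qed.

Lemma use_cong_term K G t A D l l' t1 t2 A1 :
  has_type K G t A -> wf_ctx K D -> subst_ok K D (sub l) G -> subst_eq K D (sub l) (sub l') G ->
  subst (sub l) t = t1 -> subst (sub l') t = t2 -> subst (sub l) A = A1 ->
  eq_term K D t1 t2 A1.
Proof. intros; subst; eapply functional_term; eauto. Qed.

(** Components found neither among the hypotheses nor by the checker, typically those that need a
    conversion, are left to the caller. *)
Ltac subst_ok_auto :=
  lazymatch goal with |- subst_ok ?K ?D ?s ?G =>
    let G' := eval hnf in G in change (subst_ok K D s G') end;
  lazymatch goal with
  | |- subst_ok _ _ _ [] => apply subst_ok_nil
  | |- subst_ok _ _ _ (_ :: _) =>
      apply subst_ok_cons; [subst_ok_auto | try assumption; try tc_auto]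
  end.

Ltac by_subst L l :=
  lazymatch goal with
  | |- has_type _ _ _ _ => apply (use_subst_term _ _ _ _ _ l _ _ L)
  | |- eq_term _ _ _ _ _ => apply (use_subst_eq _ _ _ _ _ _ l _ _ _ L)
  end; [tc_auto | subst_ok_auto | vm_compute; reflexivity ..].

Ltac subst_eq_auto :=
  lazymatch goal with |- subst_eq ?K ?D ?s ?s' ?G =>
    let G' := eval hnf in G in change (subst_eq K D s s' G') end;
  lazymatch goal with
  | |- subst_eq _ _ _ _ [] => apply subst_eq_nil
  | |- subst_eq _ _ _ _ (_ :: _) =>
      apply subst_eq_cons;
        [subst_eq_auto | try assumption; try (apply eq_tm_refl; first [assumption | tc_auto])]
  end.

Ltac by_cong L l l' :=
  lazymatch goal with
  | |- eq_type _ _ _ _ => apply (use_cong_type _ _ _ _ l l' _ _ L)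
  | |- eq_term _ _ _ _ _ => apply (use_cong_term _ _ _ _ _ l l' _ _ _ L)
  end; [tc_auto | subst_ok_auto | subst_eq_auto | vm_compute; reflexivity ..].

(** * Singletons *)

Definition sh (n : nat) (t : tm) : tm := Nat.iter n shift t.

Definition Singl (Y y : tm) : tm := Sig Y (Id (shift Y) (shift y) (Var 0)).

Definition singl_center (y : tm) : tm := Pair y (Refl y).

(** Both points are brought to the center by path induction, one after the other. This way no paths
    are composed, and the term is checked without conversion. *)
Definition singl_prop (Y y : tm) : tm :=
  let T := Singl Y y in
  Lam T (Lam (shift T)
    (SigInd (Id (sh 3 T) (Var 0) (Var 1))
      (J (sh 4 Y) (sh 4 y) (Id (sh 6 T) (Pair (Var 1) (Var 0)) (Var 4))
        (SigInd (Id (sh 5 T) (singl_center (sh 5 y)) (Var 0))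
          (J (sh 6 Y) (sh 6 y)
            (Id (sh 8 T) (singl_center (sh 8 y)) (Pair (Var 1) (Var 0)))
            (Refl (singl_center (sh 6 y))) (Var 1) (Var 0))
          (Var 2))
        (Var 1) (Var 0))
      (Var 1))).

Definition Fst (Y s : tm) : tm := SigInd (shift Y) (Var 1) s.

Definition Snd (Y y s : tm) : tm :=
  SigInd (Id (shift Y) (shift y) (Fst (shift Y) (Var 0))) (Var 0) s.

Lemma Fst_Pair K :
  let G := [Id (Var 2) (Var 1) (Var 0); Var 1; Var 0; U] in
  eq_term K G (Fst (Var 3) (Pair (Var 1) (Var 0))) (Var 1) (Var 3).
Proof.
  intros G.
  refine (eq_SigInd_Pair K G (Var 3) (Id (Var 4) (Var 3) (Var 0)) (Var 4) (Var 1)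
            (Var 1) (Var 0) _ _ _ _ _ _); tc_auto.
Qed.

Lemma Fst_type K : has_type K [Singl (Var 1) (Var 0); Var 0; U] (Fst (Var 2) (Var 0)) (Var 2).
Proof. tc_auto. Qed.

(** The motive of [Snd] mentions [Fst] of a pair, so its branch is well typed only after the pair is
    projected judgmentally. *)
Lemma Snd_branch K :
  let G := [Id (Var 2) (Var 1) (Var 0); Var 1; Var 0; U] in
  has_type K G (Var 0) (Id (Var 3) (Var 2) (Fst (Var 3) (Pair (Var 1) (Var 0)))).
Proof.
  intros G.
  apply tm_conv with (Id (Var 3) (Var 2) (Var 1)); [tc_auto|].
  apply eqty_Id; [apply eqty_refl; tc_auto | apply eq_tm_refl; tc_auto |].
  apply eq_tm_sym, Fst_Pair.
Qed.

Lemma Snd_type K : has_type K [Singl (Var 1) (Var 0); Var 0; U]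
  (Snd (Var 2) (Var 1) (Var 0)) (Id (Var 2) (Var 1) (Fst (Var 2) (Var 0))).
Proof.
  refine (tm_SigInd K [Singl (Var 1) (Var 0); Var 0; U] (Var 2) (Id (Var 3) (Var 2) (Var 0))
            (Id (Var 3) (Var 2) (Fst (Var 3) (Var 0))) (Var 0) (Var 0) _ _ _ _ _);
    try tc_auto.
  by_subst (Snd_branch K) [Var 0; Var 1; Var 3; Var 4].
Qed.

Lemma Snd_Pair K :
  let G := [Id (Var 2) (Var 1) (Var 0); Var 1; Var 0; U] in
  eq_term K G (Snd (Var 3) (Var 2) (Pair (Var 1) (Var 0))) (Var 0)
    (Id (Var 3) (Var 2) (Var 1)).
Proof.
  intros G.
  apply eq_conv with (Id (Var 3) (Var 2) (Fst (Var 3) (Pair (Var 1) (Var 0)))).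
  - refine (eq_SigInd_Pair K G (Var 3) (Id (Var 4) (Var 3) (Var 0))
              (Id (Var 4) (Var 3) (Fst (Var 4) (Var 0))) (Var 0)
              (Var 1) (Var 0) _ _ _ _ _ _); try tc_auto.
    by_subst (Snd_branch K) [Var 0; Var 1; Var 4; Var 5].
  - refine (eqty_Id K G (Var 3) (Var 3) (Var 2) (Var 2) _ _ (eqty_refl _ _ _ _)
              (eq_tm_refl _ _ _ _ _) (Fst_Pair K)); tc_auto.
Qed.

(** * Recursion into a singleton *)

Definition rec_singl (Y y0 y1 p z : tm) : tm :=
  TrRec Bool (Singl Y y0) (singl_prop Y y0)
    (Lam Bool (BoolInd (sh 2 (Singl Y y0)) (singl_center (shift y0))
                 (Pair (shift y1) (shift p)) (Var 0))) z.

Local Notation I2 := (Trunc Bool).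
Local Notation z0 := (Tr B0).
Local Notation z1 := (Tr B1).
Local Notation h00 := (trunc_path Bool z0 z0).
Local Notation h01 := (trunc_path Bool z0 z1).

(* Y : U, y0 : Y, y1 : Y, p : y0 = y1 *)
Definition path_ctx : ctx := [Id (Var 2) (Var 1) (Var 0); Var 1; Var 0; U].

Definition int_rec : tm :=
  Lam I2 (Fst (Var 4) (rec_singl (Var 4) (Var 3) (Var 2) (Var 1) (Var 0))).

Definition int_rec_path : tm :=
  Lam I2 (Snd (Var 4) (Var 3) (rec_singl (Var 4) (Var 3) (Var 2) (Var 1) (Var 0))).

Lemma rec_singl_B0 K :
  eq_term K path_ctx (rec_singl (Var 3) (Var 2) (Var 1) (Var 0) z0)
    (singl_center (Var 2)) (Singl (Var 3) (Var 2)).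
Proof.
  eapply eq_tm_trans; [apply eq_TrRec_Tr; tc_auto|].
  eapply eq_tm_trans;
    [apply (eq_beta K _ Bool (sh 1 (Singl (Var 3) (Var 2)))); tc_auto|].
  apply (eq_BoolInd_B0 K path_ctx (sh 1 (Singl (Var 3) (Var 2)))); tc_auto.
Qed.

Lemma rec_singl_B1 K :
  eq_term K path_ctx (rec_singl (Var 3) (Var 2) (Var 1) (Var 0) z1)
    (Pair (Var 1) (Var 0)) (Singl (Var 3) (Var 2)).
Proof.
  eapply eq_tm_trans; [apply eq_TrRec_Tr; tc_auto|].
  eapply eq_tm_trans;
    [apply (eq_beta K _ Bool (sh 1 (Singl (Var 3) (Var 2)))); tc_auto|].
  apply (eq_BoolInd_B1 K path_ctx (sh 1 (Singl (Var 3) (Var 2)))); tc_auto.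
Qed.

Lemma int_rec_type K : has_type K path_ctx int_rec (Arr I2 (Var 3)).
Proof. tc_auto. Qed.

(** Common to both endpoints. The image of [b] is replaced by the pair below [Fst] and [Snd] by
    functionality; [ET] accounts for the type of [Snd], which changes with it. *)
Lemma int_rec_comp K b v u :
  has_type K path_ctx b I2 -> has_type K path_ctx v (Var 3) ->
  has_type K path_ctx u (Id (Var 3) (Var 2) v) ->
  eq_term K path_ctx (rec_singl (Var 3) (Var 2) (Var 1) (Var 0) b) (Pair v u)
    (Singl (Var 3) (Var 2)) ->
  eq_term K path_ctx (App int_rec b) v (Var 3) /\
  eq_term K path_ctx (App int_rec_path b) u (Id (Var 3) (Var 2) v).
Proof.
  intros Hb Hv Hu E.
  set (S0 := rec_singl (Var 3) (Var 2) (Var 1) (Var 0) b).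
  set (S1 := rec_singl (Var 4) (Var 3) (Var 2) (Var 1) (Var 0)).
  assert (HS : has_type K (I2 :: path_ctx) S1 (Singl (Var 4) (Var 3))) by tc_auto.
  assert (Hs : has_type K path_ctx S0 (Singl (Var 3) (Var 2)))
    by (by_subst HS [b; Var 0; Var 1; Var 2; Var 3]).
  assert (E1 : eq_term K path_ctx (Fst (Var 3) S0) v (Var 3)).
  { eapply eq_tm_trans.
    - by_cong (Fst_type K) [S0; Var 2; Var 3] [Pair v u; Var 2; Var 3].
    - by_subst (Fst_Pair K) [u; v; Var 2; Var 3]. }
  assert (ET : eq_type K path_ctx (Id (Var 3) (Var 2) (Fst (Var 3) S0)) (Id (Var 3) (Var 2) v))
    by (apply eqty_Id; [apply eqty_refl; tc_auto | apply eq_tm_refl; tc_auto | exact E1]).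
  split; eapply eq_tm_trans.
  - apply (eq_beta K path_ctx I2 (Var 4) (Fst (Var 4) S1) b);
      [tc_auto | tc_auto | tc_auto | exact Hb].
  - exact E1.
  - apply eq_conv with (2 := ET).
    apply (eq_beta K path_ctx I2 (Id (Var 4) (Var 3) (Fst (Var 4) S1))
             (Snd (Var 4) (Var 3) S1) b); [tc_auto | tc_auto | | exact Hb].
    by_subst (Snd_type K) [S1; Var 3; Var 4].
  - eapply eq_tm_trans.
    + apply eq_conv with (2 := ET).
      by_cong (Snd_type K) [S0; Var 2; Var 3] [Pair v u; Var 2; Var 3].
    + by_subst (Snd_Pair K) [u; v; Var 2; Var 3].
Qed.

Lemma int_rec_B0 K :
  eq_term K path_ctx (App int_rec z0) (Var 2) (Var 3) /\
  eq_term K path_ctx (App int_rec_path z0) (Refl (Var 2)) (Id (Var 3) (Var 2) (Var 2)).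
Proof. apply int_rec_comp; [tc_auto .. | apply rec_singl_B0]. Qed.

Lemma int_rec_B1 K :
  eq_term K path_ctx (App int_rec z1) (Var 1) (Var 3) /\
  eq_term K path_ctx (App int_rec_path z1) (Var 0) (Id (Var 3) (Var 2) (Var 1)).
Proof. apply int_rec_comp; [tc_auto .. | apply rec_singl_B1]. Qed.

(** The homotopy is built from y0, but [ap_unique] wants one from f |0|; the computation at |0|
    makes these the same type. *)
Lemma int_rec_path_type K :
  has_type K path_ctx int_rec_path
    (Pi I2 (Id (Var 4) (App (shift int_rec) z0) (App (shift int_rec) (Var 0)))).
Proof.
  apply tm_Lam; try tc_auto.
  apply tm_conv with (Id (Var 4) (Var 3)
    (Fst (Var 4) (rec_singl (Var 4) (Var 3) (Var 2) (Var 1) (Var 0)))).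
  - by_subst (Snd_type K)
      [rec_singl (Var 4) (Var 3) (Var 2) (Var 1) (Var 0); Var 3; Var 4].
  - apply eqty_Id; [apply eqty_refl; tc_auto| |]; apply eq_tm_sym.
    + by_subst (proj1 (int_rec_B0 K)) [Var 1; Var 2; Var 3; Var 4].
    + apply (eq_beta K (I2 :: path_ctx) I2 (Var 5)); tc_auto.
Qed.

(* A : U, Y : U, a : A, f : A -> Y, h : forall x, f a = f x, n : refl = h a, x : A,
   w : a = x *)
Definition ap_ctx : ctx :=
  [ Id (Var 6) (Var 4) (Var 0);
    Var 5;
    Id (Id (Var 3) (App (Var 1) (Var 2)) (App (Var 1) (Var 2)))
      (Refl (App (Var 1) (Var 2))) (App (Var 0) (Var 2));
    Pi (Var 3) (Id (Var 3) (App (Var 1) (Var 2)) (App (Var 1) (Var 0)));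
    Arr (Var 2) (Var 1);
    Var 1; U; U ].

Lemma ap_Refl K :
  let G := [Arr (Var 2) (Var 1); Var 1; U; U] in
  eq_term K G (ap (Var 3) (Var 2) (Var 0) (Var 1) (Var 1) (Refl (Var 1)))
    (Refl (App (Var 0) (Var 1))) (Id (Var 2) (App (Var 0) (Var 1)) (App (Var 0) (Var 1))).
Proof.
  intros G.
  apply (eq_J_Refl K G (Var 3) (Var 1)
    (Id (Var 4) (App (Var 2) (Var 3)) (App (Var 2) (Var 1)))); tc_auto.
Qed.

(** Path induction on w: at refl, [ap] computes to refl, and the hypothesis n is what is asked. *)
Lemma ap_unique K : exists t, has_type K ap_ctx t
  (Id (Id (Var 6) (App (Var 4) (Var 5)) (App (Var 4) (Var 1)))
     (ap (Var 7) (Var 6) (Var 4) (Var 5) (Var 1) (Var 0)) (App (Var 3) (Var 1))).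
Proof.
  exists (J (Var 7) (Var 5)
    (Id (Id (Var 8) (App (Var 6) (Var 7)) (App (Var 6) (Var 1)))
       (ap (Var 9) (Var 8) (Var 6) (Var 7) (Var 1) (Var 0)) (App (Var 5) (Var 1)))
    (Var 2) (Var 1) (Var 0)).
  apply (tm_J K ap_ctx); try tc_auto.
  apply tm_conv with (Id (Id (Var 6) (App (Var 4) (Var 5)) (App (Var 4) (Var 5)))
      (Refl (App (Var 4) (Var 5))) (App (Var 3) (Var 5))); [tc_auto|].
  apply eqty_Id; [apply eqty_refl; tc_auto | | apply eq_tm_refl; tc_auto].
  apply eq_tm_sym. by_subst (ap_Refl K) [Var 4; Var 5; Var 6; Var 7].
Qed.

Lemma int_rec_ap K : exists t, has_type K path_ctx t
  (Id (Id (Var 3) (Var 2) (Var 1))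
     (ap I2 (Var 3) int_rec z0 z1 (trunc_path Bool z0 z1)) (Var 0)).
Proof.
  destruct (ap_unique K) as [t Ht].
  (* The hypothesis n is met by reflexivity, since [int_rec_path] computes to refl at |0|. *)
  set (l := [trunc_path Bool z0 z1; z1; Refl (Refl (App int_rec z0));
             int_rec_path; int_rec; z0; Var 3; I2]).
  assert (EE : eq_type K path_ctx
    (Id (Var 3) (App int_rec z0) (App int_rec z1))
    (Id (Var 3) (Var 2) (Var 1))).
  { apply eqty_Id; [apply eqty_refl; tc_auto|apply (int_rec_B0 K)|apply (int_rec_B1 K)]. }
  exists (subst (sub l) t).
  apply tm_conv with
    (Id (Id (Var 3) (App int_rec z0) (App int_rec z1))
       (ap I2 (Var 3) int_rec z0 z1 (trunc_path Bool z0 z1))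
       (App int_rec_path z1)).
  - apply (use_subst_term K _ _ _ _ l _ _ Ht);
      [tc_auto | subst_ok_auto | reflexivity | vm_compute; reflexivity].
    + exact (int_rec_path_type K).
    + assert (E0 : eq_type K path_ctx (Id (Var 3) (Var 2) (Var 2))
        (Id (Var 3) (App int_rec z0) (App int_rec z0))).
      { apply eqty_Id; [apply eqty_refl; tc_auto | |]; apply eq_tm_sym, (int_rec_B0 K). }
      apply tm_conv with (Id (Id (Var 3) (App int_rec z0) (App int_rec z0))
        (Refl (App int_rec z0)) (Refl (App int_rec z0))); [tc_auto|].
      apply eqty_Id; [apply eqty_refl; tc_auto | apply eq_tm_refl; tc_auto |].
      apply eq_tm_sym, eq_conv with (2 := E0).
      eapply eq_tm_trans; [apply (int_rec_B0 K)|].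
      apply eq_Refl; [tc_auto | apply eq_tm_sym, (int_rec_B0 K)].
  - apply eqty_Id; [exact EE | apply eq_tm_refl; tc_auto |].
    apply eq_conv with (2 := eqty_sym _ _ _ _ EE). apply (int_rec_B1 K).
Qed.

(** * Dependent path algebra *)

(** Transport along the inverse path, given its own path induction so that no inverse has to be
    formed. *)
Definition back (A P a x u : tm) : tm :=
  J A a (Arr (App (shift2 P) (Var 1)) (App (shift2 P) (shift2 a)))
    (Lam (App P a) (Var 0)) x u.

(* A : U, P : A -> U, a : A, v : P a *)
Definition fiber_ctx : ctx := [App (Var 1) (Var 0); Var 1; Arr (Var 0) U; U].

Lemma transport_Refl K :
  eq_term K fiber_ctx
    (App (transport (Var 3) (Var 2) (Var 1) (Var 1) (Refl (Var 1))) (Var 0))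
    (Var 0) (App (Var 2) (Var 1)).
Proof.
  eapply eq_tm_trans.
  - apply (eq_App K fiber_ctx (App (Var 2) (Var 1)) (App (Var 3) (Var 2)));
      [tc_auto | tc_auto | | apply eq_tm_refl; tc_auto].
    apply (eq_J_Refl K fiber_ctx (Var 3) (Var 1)
      (Arr (App (Var 4) (Var 3)) (App (Var 4) (Var 1)))); tc_auto.
  - apply (eq_beta K fiber_ctx (App (Var 2) (Var 1)) (App (Var 3) (Var 2))); tc_auto.
Qed.

Lemma back_Refl K :
  eq_term K fiber_ctx
    (App (back (Var 3) (Var 2) (Var 1) (Var 1) (Refl (Var 1))) (Var 0))
    (Var 0) (App (Var 2) (Var 1)).
Proof.
  eapply eq_tm_trans.
  - apply (eq_App K fiber_ctx (App (Var 2) (Var 1)) (App (Var 3) (Var 2)));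
      [tc_auto | tc_auto | | apply eq_tm_refl; tc_auto].
    apply (eq_J_Refl K fiber_ctx (Var 3) (Var 1)
      (Arr (App (Var 4) (Var 1)) (App (Var 4) (Var 3)))); tc_auto.
  - apply (eq_beta K fiber_ctx (App (Var 2) (Var 1)) (App (Var 3) (Var 2))); tc_auto.
Qed.

Definition round (A P a x u v : tm) : tm :=
  App (transport A P a x u) (App (back A P a x u) v).

Lemma round_Refl K :
  eq_term K fiber_ctx (round (Var 3) (Var 2) (Var 1) (Var 1) (Refl (Var 1)) (Var 0))
    (Var 0) (App (Var 2) (Var 1)).
Proof.
  eapply eq_tm_trans; [|apply back_Refl].
  by_subst (transport_Refl K)
    [App (back (Var 3) (Var 2) (Var 1) (Var 1) (Refl (Var 1))) (Var 0); Var 1; Var 2; Var 3].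
Qed.

(** The use is at a loop, but path induction needs the free end [x]; as [v] lies over [x], the
    motive generalises over it. *)
Definition round_path (A P a x u v : tm) : tm :=
  App (J A a
         (Pi (App (shift2 P) (Var 1))
            (Id (App (sh 3 P) (Var 2)) (Var 0)
               (round (sh 3 A) (sh 3 P) (sh 3 a) (Var 2) (Var 1) (Var 0))))
         (Lam (App P a) (Refl (Var 0))) x u) v.

Lemma round_path_type K :
  has_type K [App (Var 3) (Var 1); Id (Var 3) (Var 1) (Var 0); Var 2; Var 1; Arr (Var 0) U; U]
    (round_path (Var 5) (Var 4) (Var 3) (Var 2) (Var 1) (Var 0))
    (Id (App (Var 4) (Var 2)) (Var 0)
       (round (Var 5) (Var 4) (Var 3) (Var 2) (Var 1) (Var 0))).
Proof.
  refine (tm_App K _ (App (Var 4) (Var 2)) (Id (App (Var 5) (Var 3)) (Var 0)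
            (round (Var 6) (Var 5) (Var 4) (Var 3) (Var 2) (Var 0))) _ _ _ _ _ _);
    try tc_auto.
  apply (tm_J K _ (Var 5) (Var 3)); try tc_auto.
  apply tm_Lam; try tc_auto.
  apply tm_conv with (Id (App (Var 5) (Var 4)) (Var 0) (Var 0)); [tc_auto|].
  apply eqty_Id; [apply eqty_refl; tc_auto | apply eq_tm_refl; tc_auto |].
  apply eq_tm_sym. by_subst (round_Refl K) [Var 0; Var 4; Var 5; Var 6].
Qed.

(* e^-1 . k, by induction on [e] rather than [k], so that it computes to [k] when
   [e] is reflexivity. *)
Definition cancel (B a t e y k : tm) : tm :=
  App (J B a (Arr (Id (sh 2 B) (sh 2 a) (sh 2 y)) (Id (sh 2 B) (Var 1) (sh 2 y)))
         (Lam (Id B a y) (Var 0)) t e) k.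

Lemma cancel_type K :
  has_type K [Id (Var 4) (Var 3) (Var 0); Var 3; Id (Var 2) (Var 1) (Var 0); Var 1; Var 0; U]
    (cancel (Var 5) (Var 4) (Var 3) (Var 2) (Var 1) (Var 0)) (Id (Var 5) (Var 3) (Var 1)).
Proof. tc_auto. Qed.

Lemma cancel_Refl K :
  eq_term K path_ctx (cancel (Var 3) (Var 2) (Var 2) (Refl (Var 2)) (Var 1) (Var 0))
    (Var 0) (Id (Var 3) (Var 2) (Var 1)).
Proof.
  eapply eq_tm_trans.
  - apply (eq_App K path_ctx (Id (Var 3) (Var 2) (Var 1)) (Id (Var 4) (Var 3) (Var 2)));
      [tc_auto | tc_auto | | apply eq_tm_refl; tc_auto].
    apply (eq_J_Refl K path_ctx (Var 3) (Var 2)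
      (Arr (Id (Var 5) (Var 4) (Var 3)) (Id (Var 5) (Var 1) (Var 3)))); tc_auto.
  - apply (eq_beta K path_ctx (Id (Var 3) (Var 2) (Var 1)) (Id (Var 4) (Var 3) (Var 2))); tc_auto.
Qed.

(** The induction is on e with its end t free. The loop k stays fixed because its type does not
    mention t; s, n and m have to be generalised. *)
Definition cancel_inj_motive (B a k t e : tm) : tm :=
  Pi (Id B t a)
    (Pi (Id (Id (sh 1 B) (sh 1 t) (sh 1 a)) (Var 0)
           (cancel (sh 1 B) (sh 1 a) (sh 1 t) (sh 1 e) (sh 1 a) (Refl (sh 1 a))))
      (Pi (Id (Id (sh 2 B) (sh 2 t) (sh 2 a)) (Var 1)
             (cancel (sh 2 B) (sh 2 a) (sh 2 t) (sh 2 e) (sh 2 a) (sh 2 k)))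
        (Id (Id (sh 3 B) (sh 3 a) (sh 3 a)) (Refl (sh 3 a)) (sh 3 k)))).

(** When e is refl, both hypotheses reduce judgmentally, to s = refl and s = k. The outer [cancel],
    one dimension up, composes the inverse of the first with the second. *)
Definition cancel_inj_base (B a k : tm) : tm :=
  Lam (Id B a a)
    (Lam (Id (Id (sh 1 B) (sh 1 a) (sh 1 a)) (Var 0)
            (cancel (sh 1 B) (sh 1 a) (sh 1 a) (Refl (sh 1 a)) (sh 1 a) (Refl (sh 1 a))))
      (Lam (Id (Id (sh 2 B) (sh 2 a) (sh 2 a)) (Var 1)
              (cancel (sh 2 B) (sh 2 a) (sh 2 a) (Refl (sh 2 a)) (sh 2 a) (sh 2 k)))
        (cancel (Id (sh 3 B) (sh 3 a) (sh 3 a)) (Var 2) (Refl (sh 3 a)) (Var 1)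
           (sh 3 k) (Var 0)))).

Definition cancel_inj_J (B a k t e : tm) : tm :=
  J B a (cancel_inj_motive (sh 2 B) (sh 2 a) (sh 2 k) (Var 1) (Var 0))
    (cancel_inj_base B a k) t e.

Definition cancel_inj (B a t e k s n m : tm) : tm :=
  App (App (App (cancel_inj_J B a k t e) s) n) m.

(* B : U, a : B, t : B, e : a = t, k : a = a, s : t = a, n : s = e^-1 . refl,
   m : s = e^-1 . k *)
Definition cancel_inj_ctx : ctx :=
  [ Id (Id (Var 6) (Var 4) (Var 5)) (Var 1)
      (cancel (Var 6) (Var 5) (Var 4) (Var 3) (Var 5) (Var 2));
    Id (Id (Var 5) (Var 3) (Var 4)) (Var 0)
      (cancel (Var 5) (Var 4) (Var 3) (Var 2) (Var 4) (Refl (Var 4)));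
    Id (Var 4) (Var 2) (Var 3);
    Id (Var 3) (Var 2) (Var 2);
    Id (Var 2) (Var 1) (Var 0); Var 1; Var 0; U ].

Lemma cancel_inj_base_type K :
  has_type K [Id (Var 1) (Var 0) (Var 0); Var 0; U] (cancel_inj_base (Var 2) (Var 1) (Var 0))
    (cancel_inj_motive (Var 2) (Var 1) (Var 0) (Var 1) (Refl (Var 1))).
Proof.
  do 3 (apply tm_Lam; try tc_auto).
  by_subst (cancel_type K)
    [Var 0; Var 3; Var 1; Refl (Var 4); Var 2; Id (Var 5) (Var 4) (Var 4)].
  - apply tm_conv with (Id (Id (Var 5) (Var 4) (Var 4)) (Var 2)
      (cancel (Var 5) (Var 4) (Var 4) (Refl (Var 4)) (Var 4) (Refl (Var 4)))); [tc_auto|].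
    apply eqty_Id; [apply eqty_refl; tc_auto | apply eq_tm_refl; tc_auto |].
    by_subst (cancel_Refl K) [Refl (Var 4); Var 4; Var 4; Var 5].
  - apply tm_conv with (Id (Id (Var 5) (Var 4) (Var 4)) (Var 2)
      (cancel (Var 5) (Var 4) (Var 4) (Refl (Var 4)) (Var 4) (Var 3))); [tc_auto|].
    apply eqty_Id; [apply eqty_refl; tc_auto | apply eq_tm_refl; tc_auto |].
    by_subst (cancel_Refl K) [Var 3; Var 4; Var 4; Var 5].
Qed.

Lemma cancel_inj_type K :
  has_type K cancel_inj_ctx
    (cancel_inj (Var 7) (Var 6) (Var 5) (Var 4) (Var 3) (Var 2) (Var 1) (Var 0))
    (Id (Id (Var 7) (Var 6) (Var 6)) (Refl (Var 6)) (Var 3)).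
Proof.
  assert (HJ : has_type K cancel_inj_ctx
    (cancel_inj_J (Var 7) (Var 6) (Var 3) (Var 5) (Var 4))
    (cancel_inj_motive (Var 7) (Var 6) (Var 3) (Var 5) (Var 4))).
  { apply (tm_J K cancel_inj_ctx (Var 7) (Var 6)
      (cancel_inj_motive (Var 9) (Var 8) (Var 5) (Var 1) (Var 0))); try tc_auto.
    by_subst (cancel_inj_base_type K) [Var 3; Var 6; Var 7]. }
  (* The applications are checked with a variable as their head, since the actual head is typed only
     up to conversion; it is substituted afterwards. *)
  assert (HA : has_type K
    (cancel_inj_motive (Var 7) (Var 6) (Var 3) (Var 5) (Var 4) :: cancel_inj_ctx)
    (App (App (App (Var 0) (Var 3)) (Var 2)) (Var 1))
    (Id (Id (Var 8) (Var 7) (Var 7)) (Refl (Var 7)) (Var 4))) by tc_auto.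
  by_subst HA [cancel_inj_J (Var 7) (Var 6) (Var 3) (Var 5) (Var 4);
    Var 0; Var 1; Var 2; Var 3; Var 4; Var 5; Var 6; Var 7].
Qed.

(* [reach A P a c v e x w y k] : c x = y, where c is a section of P, e : v = c a,
   w : a = x and k : w * v = y.  At w = refl it is [cancel e k]. *)
Definition reach_motive (A P a c v x w : tm) : tm :=
  Pi (App P x)
    (Arr (Id (App (sh 1 P) (sh 1 x))
            (App (transport (sh 1 A) (sh 1 P) (sh 1 a) (sh 1 x) (sh 1 w)) (sh 1 v)) (Var 0))
       (Id (App (sh 1 P) (sh 1 x)) (App (sh 1 c) (sh 1 x)) (Var 0))).

Definition reach_base (A P a c v e : tm) : tm :=
  Lam (App P a)
    (Lam (Id (App (sh 1 P) (sh 1 a))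
            (App (transport (sh 1 A) (sh 1 P) (sh 1 a) (sh 1 a) (Refl (sh 1 a))) (sh 1 v))
            (Var 0))
       (cancel (App (sh 2 P) (sh 2 a)) (sh 2 v) (App (sh 2 c) (sh 2 a)) (sh 2 e)
          (Var 1) (Var 0))).

Definition reach_J (A P a c v e x w : tm) : tm :=
  J A a (reach_motive (sh 2 A) (sh 2 P) (sh 2 a) (sh 2 c) (sh 2 v) (Var 1) (Var 0))
    (reach_base A P a c v e) x w.

Definition reach (A P a c v e x w y k : tm) : tm :=
  App (App (reach_J A P a c v e x w) y) k.

(* A : U, P : A -> U, a : A, c : forall x, P x, v : P a, e : v = c a *)
Definition section_ctx : ctx :=
  [ Id (App (Var 3) (Var 2)) (Var 0) (App (Var 1) (Var 2));
    App (Var 2) (Var 1);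
    Pi (Var 2) (App (Var 2) (Var 0));
    Var 1; Arr (Var 0) U; U ].

Definition reach_Refl_ctx : ctx :=
  Id (App (Var 5) (Var 4))
    (App (transport (Var 6) (Var 5) (Var 4) (Var 4) (Refl (Var 4))) (Var 2)) (Var 0) ::
  App (Var 4) (Var 3) :: section_ctx.

Lemma reach_base_body_type K :
  has_type K reach_Refl_ctx
    (cancel (App (Var 6) (Var 5)) (Var 3) (App (Var 4) (Var 5)) (Var 2) (Var 1) (Var 0))
    (Id (App (Var 6) (Var 5)) (App (Var 4) (Var 5)) (Var 1)).
Proof.
  by_subst (cancel_type K) [Var 0; Var 1; Var 2; App (Var 4) (Var 5); Var 3; App (Var 6) (Var 5)].
  apply tm_conv with (Id (App (Var 6) (Var 5))
      (App (transport (Var 7) (Var 6) (Var 5) (Var 5) (Refl (Var 5))) (Var 3)) (Var 1));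
    [tc_auto|].
  apply eqty_Id; [apply eqty_refl; tc_auto | | apply eq_tm_refl; tc_auto].
  by_subst (transport_Refl K) [Var 3; Var 5; Var 6; Var 7].
Qed.

Lemma reach_base_type K :
  has_type K section_ctx (reach_base (Var 5) (Var 4) (Var 3) (Var 2) (Var 1) (Var 0))
    (reach_motive (Var 5) (Var 4) (Var 3) (Var 2) (Var 1) (Var 3) (Refl (Var 3))).
Proof. do 2 (apply tm_Lam; try tc_auto). apply reach_base_body_type. Qed.

Lemma reach_J_type K :
  has_type K (Id (Var 6) (Var 4) (Var 0) :: Var 5 :: section_ctx)
    (reach_J (Var 7) (Var 6) (Var 5) (Var 4) (Var 3) (Var 2) (Var 1) (Var 0))
    (reach_motive (Var 7) (Var 6) (Var 5) (Var 4) (Var 3) (Var 1) (Var 0)).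
Proof.
  apply (tm_J K _ (Var 7) (Var 5)
      (reach_motive (Var 9) (Var 8) (Var 7) (Var 6) (Var 5) (Var 1) (Var 0))); try tc_auto.
  by_subst (reach_base_type K) [Var 2; Var 3; Var 4; Var 5; Var 6; Var 7].
Qed.

Definition reach_ctx : ctx :=
  Id (App (Var 7) (Var 2)) (App (transport (Var 8) (Var 7) (Var 6) (Var 2) (Var 1)) (Var 4))
    (Var 0) :: App (Var 6) (Var 1) :: Id (Var 6) (Var 4) (Var 0) :: Var 5 :: section_ctx.

Lemma reach_type K :
  has_type K reach_ctx
    (reach (Var 9) (Var 8) (Var 7) (Var 6) (Var 5) (Var 4) (Var 3) (Var 2) (Var 1) (Var 0))
    (Id (App (Var 8) (Var 3)) (App (Var 6) (Var 3)) (Var 1)).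
Proof.
  assert (HJ : has_type K reach_ctx
    (reach_J (Var 9) (Var 8) (Var 7) (Var 6) (Var 5) (Var 4) (Var 3) (Var 2))
    (reach_motive (Var 9) (Var 8) (Var 7) (Var 6) (Var 5) (Var 3) (Var 2)))
    by (by_subst (reach_J_type K)
          [Var 2; Var 3; Var 4; Var 5; Var 6; Var 7; Var 8; Var 9]).
  assert (HA : has_type K
    (reach_motive (Var 9) (Var 8) (Var 7) (Var 6) (Var 5) (Var 3) (Var 2) :: reach_ctx)
    (App (App (Var 0) (Var 2)) (Var 1))
    (Id (App (Var 9) (Var 4)) (App (Var 7) (Var 4)) (Var 2))) by tc_auto.
  by_subst HA [reach_J (Var 9) (Var 8) (Var 7) (Var 6) (Var 5) (Var 4) (Var 3) (Var 2);
    Var 0; Var 1; Var 2; Var 3; Var 4; Var 5; Var 6; Var 7; Var 8; Var 9].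
Qed.

(** The computation rule of [J], then one beta step for each of the two abstractions of
    [reach_base]. *)
Lemma reach_Refl K :
  eq_term K reach_Refl_ctx
    (reach (Var 7) (Var 6) (Var 5) (Var 4) (Var 3) (Var 2) (Var 5) (Refl (Var 5)) (Var 1) (Var 0))
    (cancel (App (Var 6) (Var 5)) (Var 3) (App (Var 4) (Var 5)) (Var 2) (Var 1) (Var 0))
    (Id (App (Var 6) (Var 5)) (App (Var 4) (Var 5)) (Var 1)).
Proof.
  set (base := reach_base (Var 7) (Var 6) (Var 5) (Var 4) (Var 3) (Var 2)).
  set (body := cancel (App (Var 7) (Var 6)) (Var 4) (App (Var 5) (Var 6)) (Var 3)
                 (Var 2) (Var 0)).
  set (dom := Id (App (Var 6) (Var 5))
      (App (transport (Var 7) (Var 6) (Var 5) (Var 5) (Refl (Var 5))) (Var 3)) (Var 1)).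
  set (cod := Id (App (Var 6) (Var 5)) (App (Var 4) (Var 5)) (Var 1)).
  assert (Hbase : has_type K reach_Refl_ctx base
    (reach_motive (Var 7) (Var 6) (Var 5) (Var 4) (Var 3) (Var 5) (Refl (Var 5))))
    by (by_subst (reach_base_type K) [Var 2; Var 3; Var 4; Var 5; Var 6; Var 7]).
  assert (Hbody : has_type K (dom :: reach_Refl_ctx) body (shift cod))
    by (by_subst (reach_base_body_type K)
          [Var 0; Var 2; Var 3; Var 4; Var 5; Var 6; Var 7; Var 8]).
  assert (E1 : eq_term K reach_Refl_ctx
    (reach_J (Var 7) (Var 6) (Var 5) (Var 4) (Var 3) (Var 2) (Var 5) (Refl (Var 5))) base
    (reach_motive (Var 7) (Var 6) (Var 5) (Var 4) (Var 3) (Var 5) (Refl (Var 5)))).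
  { apply (eq_J_Refl K reach_Refl_ctx (Var 7) (Var 5)
      (reach_motive (Var 9) (Var 8) (Var 7) (Var 6) (Var 5) (Var 1) (Var 0)));
      try exact Hbase; tc_auto. }
  assert (E2 : eq_term K reach_Refl_ctx (App base (Var 1)) (Lam dom body) (Arr dom cod)).
  { apply (eq_beta K reach_Refl_ctx (App (Var 6) (Var 5))
      (Arr (Id (App (Var 7) (Var 6))
              (App (transport (Var 8) (Var 7) (Var 6) (Var 6) (Refl (Var 6))) (Var 4)) (Var 0))
         (Id (App (Var 7) (Var 6)) (App (Var 5) (Var 6)) (Var 0)))); try tc_auto.
    apply tm_Lam; try tc_auto.
    by_subst (reach_base_body_type K)
      [Var 0; Var 1; Var 4; Var 5; Var 6; Var 7; Var 8; Var 9]. }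
  eapply eq_tm_trans;
    [|apply (eq_beta K reach_Refl_ctx dom (shift cod) body (Var 0)); try exact Hbody; tc_auto].
  apply (eq_App K reach_Refl_ctx dom (shift cod));
    [tc_auto | tc_auto | | apply eq_tm_refl; tc_auto].
  eapply eq_tm_trans; [|exact E2].
  apply (eq_App K reach_Refl_ctx (App (Var 6) (Var 5))
      (Arr (Id (App (Var 7) (Var 6))
              (App (transport (Var 8) (Var 7) (Var 6) (Var 6) (Refl (Var 6))) (Var 4)) (Var 0))
         (Id (App (Var 7) (Var 6)) (App (Var 5) (Var 6)) (Var 0))));
    [tc_auto | tc_auto | exact E1 | apply eq_tm_refl; tc_auto].
Qed.

(** * Uniqueness of the dependent action on paths *)

(* A : U, P : A -> U, a : A, g : forall x, P x, x : A, w : a = x *)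
Definition apd_ctx : ctx :=
  [Id (Var 4) (Var 2) (Var 0); Var 3; Pi (Var 2) (App (Var 2) (Var 0));
   Var 1; Arr (Var 0) U; U].

(** [Refl] fits because transport along refl is judgmentally the identity. *)
Lemma apd_base_type K :
  has_type K [Pi (Var 2) (App (Var 2) (Var 0)); Var 1; Arr (Var 0) U; U]
    (Refl (App (Var 0) (Var 1)))
    (Id (App (Var 2) (Var 1))
       (App (transport (Var 3) (Var 2) (Var 1) (Var 1) (Refl (Var 1))) (App (Var 0) (Var 1)))
       (App (Var 0) (Var 1))).
Proof.
  apply tm_conv with (Id (App (Var 2) (Var 1)) (App (Var 0) (Var 1)) (App (Var 0) (Var 1)));
    [tc_auto|].
  apply eqty_Id; [apply eqty_refl; tc_auto | | apply eq_tm_refl; tc_auto].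
  apply eq_tm_sym. by_subst (transport_Refl K) [App (Var 0) (Var 1); Var 1; Var 2; Var 3].
Qed.

Lemma apd_type K :
  has_type K apd_ctx (apd (Var 5) (Var 4) (Var 2) (Var 3) (Var 1) (Var 0))
    (Id (App (Var 4) (Var 1))
       (App (transport (Var 5) (Var 4) (Var 3) (Var 1) (Var 0)) (App (Var 2) (Var 3)))
       (App (Var 2) (Var 1))).
Proof.
  apply (tm_J K apd_ctx (Var 5) (Var 3)
    (Id (App (Var 6) (Var 1))
       (App (transport (Var 7) (Var 6) (Var 5) (Var 1) (Var 0)) (App (Var 4) (Var 5)))
       (App (Var 4) (Var 1)))); try tc_auto.
  by_subst (apd_base_type K) [Var 2; Var 3; Var 4; Var 5].
Qed.

Lemma apd_Refl K :
  eq_term K [Pi (Var 2) (App (Var 2) (Var 0)); Var 1; Arr (Var 0) U; U]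
    (apd (Var 3) (Var 2) (Var 0) (Var 1) (Var 1) (Refl (Var 1))) (Refl (App (Var 0) (Var 1)))
    (Id (App (Var 2) (Var 1))
       (App (transport (Var 3) (Var 2) (Var 1) (Var 1) (Refl (Var 1))) (App (Var 0) (Var 1)))
       (App (Var 0) (Var 1))).
Proof.
  apply (eq_J_Refl K _ (Var 3) (Var 1)
    (Id (App (Var 4) (Var 1))
       (App (transport (Var 5) (Var 4) (Var 3) (Var 1) (Var 0)) (App (Var 2) (Var 3)))
       (App (Var 2) (Var 1)))); try tc_auto.
  apply apd_base_type.
Qed.

(** The point v of [reach] is taken to be g a, which gives k the type of [apd]. Since that type
    mentions x and w, k and the hypothesis on it are generalised. *)
Definition apd_unique_motive (A P a c g e h x w : tm) : tm :=
  Pi (Id (App P x) (App (transport A P a x w) (App g a)) (App g x))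
    (Arr
      (Id (Id (App (sh 1 P) (sh 1 x)) (App (sh 1 c) (sh 1 x)) (App (sh 1 g) (sh 1 x)))
         (App (sh 1 h) (sh 1 x))
         (reach (sh 1 A) (sh 1 P) (sh 1 a) (sh 1 c) (App (sh 1 g) (sh 1 a)) (sh 1 e)
            (sh 1 x) (sh 1 w) (App (sh 1 g) (sh 1 x)) (Var 0)))
      (Id (Id (App (sh 1 P) (sh 1 x))
             (App (transport (sh 1 A) (sh 1 P) (sh 1 a) (sh 1 x) (sh 1 w))
                (App (sh 1 g) (sh 1 a)))
             (App (sh 1 g) (sh 1 x)))
         (apd (sh 1 A) (sh 1 P) (sh 1 g) (sh 1 a) (sh 1 x) (sh 1 w)) (Var 0))).

(** At w = refl the hypotheses read h a = e^-1 . refl and h a = e^-1 . k, the input of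
    [cancel_inj]. *)
Definition apd_unique_base (P a c g e h n : tm) : tm :=
  Lam (Id (App P a) (App g a) (App g a))
    (Lam
      (Id (Id (App (sh 1 P) (sh 1 a)) (App (sh 1 c) (sh 1 a)) (App (sh 1 g) (sh 1 a)))
         (App (sh 1 h) (sh 1 a))
         (cancel (App (sh 1 P) (sh 1 a)) (App (sh 1 g) (sh 1 a)) (App (sh 1 c) (sh 1 a))
            (sh 1 e) (App (sh 1 g) (sh 1 a)) (Var 0)))
      (cancel_inj (App (sh 2 P) (sh 2 a)) (App (sh 2 g) (sh 2 a)) (App (sh 2 c) (sh 2 a))
         (sh 2 e) (Var 1) (App (sh 2 h) (sh 2 a)) (sh 2 n) (Var 0))).

Definition apd_unique (A P a c g e h n x w : tm) : tm :=
  J A a (apd_unique_motive (sh 2 A) (sh 2 P) (sh 2 a) (sh 2 c) (sh 2 g) (sh 2 e) (sh 2 h)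
           (Var 1) (Var 0))
    (apd_unique_base P a c g e h n) x w.

(* A : U, P : A -> U, a : A, c : forall x, P x, g : forall x, P x, e : g a = c a,
   h : forall x, c x = g x, n : h a = e^-1 . refl *)
Definition homotopy_ctx : ctx :=
  [ Id (Id (App (Var 5) (Var 4)) (App (Var 3) (Var 4)) (App (Var 2) (Var 4)))
      (App (Var 0) (Var 4))
      (cancel (App (Var 5) (Var 4)) (App (Var 2) (Var 4)) (App (Var 3) (Var 4)) (Var 1)
         (App (Var 2) (Var 4)) (Refl (App (Var 2) (Var 4))));
    Pi (Var 5) (Id (App (Var 5) (Var 0)) (App (Var 3) (Var 0)) (App (Var 2) (Var 0)));
    Id (App (Var 3) (Var 2)) (App (Var 0) (Var 2)) (App (Var 1) (Var 2));
    Pi (Var 3) (App (Var 3) (Var 0));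
    Pi (Var 2) (App (Var 2) (Var 0));
    Var 1; Arr (Var 0) U; U ].

Lemma apd_unique_motive_type K :
  is_type K (Id (Var 8) (Var 6) (Var 0) :: Var 7 :: homotopy_ctx)
    (apd_unique_motive (Var 9) (Var 8) (Var 7) (Var 6) (Var 5) (Var 4) (Var 3)
       (Var 1) (Var 0)).
Proof.
  apply ty_Pi; [tc_auto|]. apply Arr_type; apply ty_Id; try tc_auto.
  - by_subst (reach_type K)
      [Var 0; App (Var 6) (Var 2); Var 1; Var 2; Var 5; App (Var 6) (Var 8); Var 7; Var 8;
       Var 9; Var 10].
  - by_subst (apd_type K) [Var 1; Var 2; Var 6; Var 8; Var 9; Var 10].
Qed.

Lemma apd_unique_base_type K :
  has_type K homotopy_ctx
    (apd_unique_base (Var 6) (Var 5) (Var 4) (Var 3) (Var 2) (Var 1) (Var 0))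
    (apd_unique_motive (Var 7) (Var 6) (Var 5) (Var 4) (Var 3) (Var 2) (Var 1)
       (Var 5) (Refl (Var 5))).
Proof.
  set (K1 := Id (App (Var 6) (Var 5)) (App (Var 3) (Var 5)) (App (Var 3) (Var 5))).
  set (T1 := Id (App (Var 7) (Var 6)) (App (Var 5) (Var 6)) (App (Var 4) (Var 6))).
  set (M1 := Id T1 (App (Var 2) (Var 6))
    (cancel (App (Var 7) (Var 6)) (App (Var 4) (Var 6)) (App (Var 5) (Var 6)) (Var 3)
       (App (Var 4) (Var 6)) (Var 0))).
  set (C1 := Id (Id (App (Var 7) (Var 6)) (App (Var 4) (Var 6)) (App (Var 4) (Var 6)))
    (Refl (App (Var 4) (Var 6))) (Var 0)).
  (* This is the motive at refl with [transport], [reach] and [apd] already computed; the second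
     half of the proof converts it back. *)
  apply tm_conv with (Pi K1 (Arr M1 C1)).
  - apply tm_Lam; try tc_auto. apply tm_Lam; try tc_auto.
    by_subst (cancel_inj_type K)
      [Var 0; Var 2; App (Var 3) (Var 7); Var 1; Var 4; App (Var 6) (Var 7);
       App (Var 5) (Var 7); App (Var 8) (Var 7)].
  - assert (EK : eq_type K (K1 :: homotopy_ctx) (shift K1)
      (Id (App (Var 7) (Var 6))
         (App (transport (Var 8) (Var 7) (Var 6) (Var 6) (Refl (Var 6))) (App (Var 4) (Var 6)))
         (App (Var 4) (Var 6)))).
    { apply eqty_Id; [apply eqty_refl; tc_auto | | apply eq_tm_refl; tc_auto].
      apply eq_tm_sym. by_subst (transport_Refl K) [App (Var 4) (Var 6); Var 6; Var 7; Var 8]. }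
    apply eqty_Pi; [tc_auto | |].
    + apply eqty_Id; [apply eqty_refl; tc_auto | | apply eq_tm_refl; tc_auto].
      apply eq_tm_sym. by_subst (transport_Refl K) [App (Var 3) (Var 5); Var 5; Var 6; Var 7].
    + apply eqty_Pi; [tc_auto | |].
      * apply eqty_Id; [apply eqty_refl; tc_auto | apply eq_tm_refl; tc_auto |].
        apply eq_tm_sym.
        by_subst (reach_Refl K)
          [Var 0; App (Var 4) (Var 6); Var 3; App (Var 4) (Var 6); Var 5; Var 6; Var 7; Var 8].
        apply tm_conv with (2 := EK). tc_auto.
      * apply eqty_Id; [| |apply eq_tm_refl; tc_auto].
        -- apply eqty_Id; [apply eqty_refl; tc_auto | | apply eq_tm_refl; tc_auto].
           apply eq_tm_sym.
           by_subst (transport_Refl K) [App (Var 5) (Var 7); Var 7; Var 8; Var 9].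
        -- apply eq_tm_sym.
           apply eq_conv with (Id (App (Var 8) (Var 7))
             (App (transport (Var 9) (Var 8) (Var 7) (Var 7) (Refl (Var 7))) (App (Var 5) (Var 7)))
             (App (Var 5) (Var 7))).
           ++ by_subst (apd_Refl K) [Var 5; Var 7; Var 8; Var 9].
           ++ apply eqty_Id; [apply eqty_refl; tc_auto | | apply eq_tm_refl; tc_auto].
              by_subst (transport_Refl K) [App (Var 5) (Var 7); Var 7; Var 8; Var 9].
Qed.

Lemma apd_unique_type K :
  has_type K (Id (Var 8) (Var 6) (Var 0) :: Var 7 :: homotopy_ctx)
    (apd_unique (Var 9) (Var 8) (Var 7) (Var 6) (Var 5) (Var 4) (Var 3) (Var 2)
       (Var 1) (Var 0))
    (apd_unique_motive (Var 9) (Var 8) (Var 7) (Var 6) (Var 5) (Var 4) (Var 3)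
       (Var 1) (Var 0)).
Proof.
  set (G := Id (Var 8) (Var 6) (Var 0) :: Var 7 :: homotopy_ctx).
  apply (tm_J K G (Var 9) (Var 7)
    (apd_unique_motive (Var 11) (Var 10) (Var 9) (Var 8) (Var 7) (Var 6) (Var 5)
       (Var 1) (Var 0))); try tc_auto.
  - assert (H := subst_type K _ _ (Id (Var 10) (Var 8) (Var 0) :: Var 9 :: G)
      (sub [Var 0; Var 1; Var 4; Var 5; Var 6; Var 7; Var 8; Var 9; Var 10; Var 11])
      (apd_unique_motive_type K)).
    apply H; [tc_auto | subst_ok_auto].
  - by_subst (apd_unique_base_type K)
      [Var 2; Var 3; Var 4; Var 5; Var 6; Var 7; Var 8; Var 9].
Qed.

(** * Induction into a family of singletons *)

Definition singl_fam (P c : tm) : tm :=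
  Lam I2 (Singl (App (sh 1 P) (Var 0)) (App (sh 1 c) (Var 0))).

Definition singl_fam_prop (P c : tm) : tm :=
  Lam I2 (singl_prop (App (sh 1 P) (Var 0)) (App (sh 1 c) (Var 0))).

Definition singl_ends (P c a0 e0 a1 e1 : tm) : tm :=
  Lam Bool (BoolInd (Singl (App (sh 2 P) (Tr (Var 0))) (App (sh 2 c) (Tr (Var 0))))
    (Pair (sh 1 a0) (sh 1 e0)) (Pair (sh 1 a1) (sh 1 e1)) (Var 0)).

Definition ind_singl (P c a0 e0 a1 e1 z : tm) : tm :=
  TrInd Bool (singl_fam P c) (singl_fam_prop P c) (singl_ends P c a0 e0 a1 e1) z.

(* P : ||2|| -> U, a0 : P |0|, a1 : P |1|, c : forall z, P z, e0 : c |0| = a0,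
   e1 : c |1| = a1 *)
Definition ends_ctx : ctx :=
  [ Id (App (Var 4) z1) (App (Var 1) z1) (Var 2);
    Id (App (Var 3) z0) (App (Var 0) z0) (Var 2);
    Pi I2 (App (Var 3) (Var 0));
    App (Var 1) z1;
    App (Var 0) z0;
    Arr I2 U ].

(** [TrInd] takes its family as a function, so a fibre must be beta-reduced before a pair fits into
    it. *)
Lemma singl_fam_eq K :
  eq_term K [I2; Pi I2 (App (Var 1) (Var 0)); Arr I2 U]
    (App (singl_fam (Var 2) (Var 1)) (Var 0))
    (Singl (App (Var 2) (Var 0)) (App (Var 1) (Var 0))) U.
Proof.
  apply (eq_beta K _ I2 U (Singl (App (Var 3) (Var 0)) (App (Var 2) (Var 0)))); tc_auto.
Qed.

(** Over a variable type, so that functionality can carry the beta reduction of a fibre inside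
    [isProp]. *)
Lemma isProp_small K : has_type K [U] (isProp (Var 0)) U.
Proof. tc_auto. Qed.

Lemma singl_fam_prop_type K :
  has_type K [Pi I2 (App (Var 1) (Var 0)); Arr I2 U] (singl_fam_prop (Var 1) (Var 0))
    (Pi I2 (isProp (App (shift (singl_fam (Var 1) (Var 0))) (Var 0)))).
Proof.
  apply tm_conv with (Pi I2 (isProp (Singl (App (Var 2) (Var 0)) (App (Var 1) (Var 0)))));
    [tc_auto|].
  apply eqty_Pi; [tc_auto | apply eqty_refl; tc_auto |]. apply eqty_small.
  by_cong (isProp_small K) [Singl (App (Var 2) (Var 0)) (App (Var 1) (Var 0))]
    [App (singl_fam (Var 2) (Var 1)) (Var 0)].
  apply eq_tm_sym, singl_fam_eq.
Qed.

Lemma singl_ends_type K :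
  has_type K ends_ctx (singl_ends (Var 5) (Var 2) (Var 4) (Var 1) (Var 3) (Var 0))
    (Pi Bool (App (shift (singl_fam (Var 5) (Var 2))) (Tr (Var 0)))).
Proof.
  apply tm_conv with
    (Pi Bool (Singl (App (Var 6) (Tr (Var 0))) (App (Var 3) (Tr (Var 0))))); [tc_auto|].
  apply eqty_Pi; [tc_auto | apply eqty_refl; tc_auto |]. apply eqty_small, eq_tm_sym.
  by_subst (singl_fam_eq K) [Tr (Var 0); Var 3; Var 6].
Qed.

Lemma ind_singl_type :
  has_type RecAndInd (I2 :: ends_ctx)
    (ind_singl (Var 6) (Var 3) (Var 5) (Var 2) (Var 4) (Var 1) (Var 0))
    (Singl (App (Var 6) (Var 0)) (App (Var 3) (Var 0))).
Proof.
  apply tm_conv with (App (singl_fam (Var 6) (Var 3)) (Var 0)).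
  - apply tm_TrInd; try tc_auto; [reflexivity | |].
    + by_subst (singl_fam_prop_type RecAndInd) [Var 3; Var 6].
    + by_subst (singl_ends_type RecAndInd) [Var 1; Var 2; Var 3; Var 4; Var 5; Var 6].
  - apply eqty_small. by_subst (singl_fam_eq RecAndInd) [Var 0; Var 3; Var 6].
Qed.

Lemma ind_singl_Tr b :
  has_type RecAndInd ends_ctx b Bool ->
  eq_term RecAndInd ends_ctx
    (ind_singl (Var 5) (Var 2) (Var 4) (Var 1) (Var 3) (Var 0) (Tr b))
    (App (singl_ends (Var 5) (Var 2) (Var 4) (Var 1) (Var 3) (Var 0)) b)
    (Singl (App (Var 5) (Tr b)) (App (Var 2) (Tr b))).
Proof.
  intros Hb.
  assert (HTb : has_type RecAndInd ends_ctx (Tr b) I2) by (apply tm_Tr; [tc_auto | exact Hb]).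
  apply eq_conv with (App (singl_fam (Var 5) (Var 2)) (Tr b)).
  - apply eq_TrInd_Tr; [reflexivity | tc_auto | tc_auto | | apply singl_ends_type | exact Hb].
    by_subst (singl_fam_prop_type RecAndInd) [Var 2; Var 5].
  - apply eqty_small. by_subst (singl_fam_eq RecAndInd) [Tr b; Var 2; Var 5].
Qed.

Lemma ind_singl_B0 :
  eq_term RecAndInd ends_ctx
    (ind_singl (Var 5) (Var 2) (Var 4) (Var 1) (Var 3) (Var 0) z0)
    (Pair (Var 4) (Var 1)) (Singl (App (Var 5) z0) (App (Var 2) z0)).
Proof.
  eapply eq_tm_trans; [apply ind_singl_Tr; tc_auto|].
  eapply eq_tm_trans.
  - apply (eq_beta RecAndInd ends_ctx Bool
      (Singl (App (Var 6) (Tr (Var 0))) (App (Var 3) (Tr (Var 0))))); tc_auto.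
  - apply (eq_BoolInd_B0 RecAndInd ends_ctx
      (Singl (App (Var 6) (Tr (Var 0))) (App (Var 3) (Tr (Var 0))))); tc_auto.
Qed.

Lemma ind_singl_B1 :
  eq_term RecAndInd ends_ctx
    (ind_singl (Var 5) (Var 2) (Var 4) (Var 1) (Var 3) (Var 0) z1)
    (Pair (Var 3) (Var 0)) (Singl (App (Var 5) z1) (App (Var 2) z1)).
Proof.
  eapply eq_tm_trans; [apply ind_singl_Tr; tc_auto|].
  eapply eq_tm_trans.
  - apply (eq_beta RecAndInd ends_ctx Bool
      (Singl (App (Var 6) (Tr (Var 0))) (App (Var 3) (Tr (Var 0))))); tc_auto.
  - apply (eq_BoolInd_B1 RecAndInd ends_ctx
      (Singl (App (Var 6) (Tr (Var 0))) (App (Var 3) (Tr (Var 0))))); tc_auto.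
Qed.

Definition int_ind (P c a0 e0 a1 e1 : tm) : tm :=
  Lam I2 (Fst (App (sh 1 P) (Var 0))
    (ind_singl (sh 1 P) (sh 1 c) (sh 1 a0) (sh 1 e0) (sh 1 a1) (sh 1 e1) (Var 0))).

Definition int_ind_path (P c a0 e0 a1 e1 : tm) : tm :=
  Lam I2 (Snd (App (sh 1 P) (Var 0)) (App (sh 1 c) (Var 0))
    (ind_singl (sh 1 P) (sh 1 c) (sh 1 a0) (sh 1 e0) (sh 1 a1) (sh 1 e1) (Var 0))).

Local Notation the_ind := (int_ind (Var 5) (Var 2) (Var 4) (Var 1) (Var 3) (Var 0)).
Local Notation the_ind_path := (int_ind_path (Var 5) (Var 2) (Var 4) (Var 1) (Var 3) (Var 0)).
Local Notation the_ind_singl := (ind_singl (Var 5) (Var 2) (Var 4) (Var 1) (Var 3) (Var 0)).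
Local Notation the_ind_singl' :=
  (ind_singl (Var 6) (Var 3) (Var 5) (Var 2) (Var 4) (Var 1) (Var 0)).

Lemma int_ind_body_type :
  has_type RecAndInd (I2 :: ends_ctx)
    (Fst (App (Var 6) (Var 0)) the_ind_singl') (App (Var 6) (Var 0)).
Proof.
  assert (H := ind_singl_type).
  by_subst (Fst_type RecAndInd) [the_ind_singl'; App (Var 3) (Var 0); App (Var 6) (Var 0)].
Qed.

Lemma int_ind_path_body_type :
  has_type RecAndInd (I2 :: ends_ctx)
    (Snd (App (Var 6) (Var 0)) (App (Var 3) (Var 0)) the_ind_singl')
    (Id (App (Var 6) (Var 0)) (App (Var 3) (Var 0)) (Fst (App (Var 6) (Var 0)) the_ind_singl')).
Proof.
  assert (H := ind_singl_type).
  by_subst (Snd_type RecAndInd) [the_ind_singl'; App (Var 3) (Var 0); App (Var 6) (Var 0)].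
Qed.

Lemma int_ind_type : has_type RecAndInd ends_ctx the_ind (Pi I2 (App (Var 6) (Var 0))).
Proof. apply tm_Lam; try tc_auto. apply int_ind_body_type. Qed.

Lemma int_ind_path_type :
  has_type RecAndInd ends_ctx the_ind_path
    (Pi I2 (Id (App (Var 6) (Var 0)) (App (Var 3) (Var 0)) (App (shift the_ind) (Var 0)))).
Proof.
  assert (Hg : has_type RecAndInd (I2 :: ends_ctx) (App (shift the_ind) (Var 0))
                 (App (Var 6) (Var 0))).
  { apply (tm_App RecAndInd _ I2 (App (Var 7) (Var 0))); try tc_auto.
    by_subst int_ind_type [Var 1; Var 2; Var 3; Var 4; Var 5; Var 6]. }
  apply tm_Lam; [tc_auto | apply ty_Id; [tc_auto | tc_auto | exact Hg] |].
  apply tm_conv with (1 := int_ind_path_body_type).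
  apply eqty_Id; [apply eqty_refl; tc_auto | apply eq_tm_refl; tc_auto |].
  apply eq_tm_sym.
  apply (eq_beta RecAndInd (I2 :: ends_ctx) I2 (App (Var 7) (Var 0))); try tc_auto.
  by_subst int_ind_body_type
    [Var 0; Var 2; Var 3; Var 4; Var 5; Var 6; Var 7].
Qed.

(** Dependent counterpart of [int_rec_comp]. As [b] is not concrete, the types over it are derived
    by hand. *)
Lemma int_ind_comp b v u :
  has_type RecAndInd ends_ctx b I2 ->
  has_type RecAndInd ends_ctx v (App (Var 5) b) ->
  has_type RecAndInd ends_ctx u (Id (App (Var 5) b) (App (Var 2) b) v) ->
  eq_term RecAndInd ends_ctx (the_ind_singl b) (Pair v u)
    (Singl (App (Var 5) b) (App (Var 2) b)) ->
  eq_term RecAndInd ends_ctx (App the_ind b) v (App (Var 5) b) /\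
  eq_term RecAndInd ends_ctx (App the_ind_path b) u (Id (App (Var 5) b) (App (Var 2) b) v).
Proof.
  intros Hb Hv Hu E.
  assert (HPb : has_type RecAndInd ends_ctx (App (Var 5) b) U)
    by (apply family_App with I2; [tc_auto | tc_auto | exact Hb]).
  assert (Hcb : has_type RecAndInd ends_ctx (App (Var 2) b) (App (Var 5) b))
    by (apply (tm_App RecAndInd ends_ctx I2 (App (Var 6) (Var 0))); [tc_auto ..| exact Hb]).
  assert (Hs : has_type RecAndInd ends_ctx (the_ind_singl b)
                 (Singl (App (Var 5) b) (App (Var 2) b)))
    by (by_subst ind_singl_type [b; Var 0; Var 1; Var 2; Var 3; Var 4; Var 5]).
  assert (E1 : eq_term RecAndInd ends_ctx (Fst (App (Var 5) b) (the_ind_singl b)) v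
                 (App (Var 5) b)).
  { eapply eq_tm_trans.
    - by_cong (Fst_type RecAndInd) [the_ind_singl b; App (Var 2) b; App (Var 5) b]
        [Pair v u; App (Var 2) b; App (Var 5) b].
    - by_subst (Fst_Pair RecAndInd) [u; v; App (Var 2) b; App (Var 5) b]. }
  assert (ET : eq_type RecAndInd ends_ctx
    (Id (App (Var 5) b) (App (Var 2) b) (Fst (App (Var 5) b) (the_ind_singl b)))
    (Id (App (Var 5) b) (App (Var 2) b) v)).
  { apply eqty_Id; auto using eqty_refl, ty_small, eq_tm_refl. }
  split; eapply eq_tm_trans.
  - apply (eq_beta RecAndInd ends_ctx I2 (App (Var 6) (Var 0))
      (Fst (App (Var 6) (Var 0)) the_ind_singl') b);
      [tc_auto | tc_auto | exact int_ind_body_type | exact Hb].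
  - exact E1.
  - apply eq_conv with (2 := ET).
    apply (eq_beta RecAndInd ends_ctx I2
      (Id (App (Var 6) (Var 0)) (App (Var 3) (Var 0)) (Fst (App (Var 6) (Var 0)) the_ind_singl'))
      (Snd (App (Var 6) (Var 0)) (App (Var 3) (Var 0)) the_ind_singl') b);
      [tc_auto | | exact int_ind_path_body_type | exact Hb].
    apply ty_Id; [tc_auto | tc_auto | exact int_ind_body_type].
  - eapply eq_tm_trans.
    + apply eq_conv with (2 := ET).
      by_cong (Snd_type RecAndInd) [the_ind_singl b; App (Var 2) b; App (Var 5) b]
        [Pair v u; App (Var 2) b; App (Var 5) b].
    + by_subst (Snd_Pair RecAndInd) [u; v; App (Var 2) b; App (Var 5) b].
Qed.

(** * The induction principle of the interval *)

(* P : ||2|| -> U, a0 : P |0|, a1 : P |1|, q : h01 * a0 = a1 *)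
Definition glue_ctx : ctx :=
  [ Id (App (Var 2) z1) (App (transport I2 (Var 2) z0 z1 h01) (Var 1)) (Var 0);
    App (Var 1) z1; App (Var 0) z0; Arr I2 U ].

(* Transporting back along the loop [h00] first makes the value at |0| equal to
   [a0] without knowing that [h00] is trivial. *)
Definition center : tm :=
  Lam I2 (App (transport I2 (Var 4) z0 (Var 0) (trunc_path Bool z0 (Var 0)))
    (App (back I2 (Var 4) z0 z0 h00) (Var 3))).

Definition center_path : tm := round_path I2 (Var 3) z0 z0 h00 (Var 2).

(** Both ends are written with the operations that occur in the hypotheses of [apd_unique], so that
    these hypotheses hold by reflexivity at |0| and at |1|; an arbitrary path from the section to
    the endpoint would not do. *)
Definition end0 : tm :=
  cancel (App (Var 3) z0) (Var 2) (App center z0) center_path (Var 2) (Refl (Var 2)).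

Definition end1 : tm :=
  reach I2 (Var 3) z0 center (Var 2) center_path z1 h01 (Var 1) (Var 0).

Lemma center_type K : has_type K glue_ctx center (Pi I2 (App (Var 4) (Var 0))).
Proof. tc_auto. Qed.

Lemma center_path_type K :
  has_type K glue_ctx center_path (Id (App (Var 3) z0) (Var 2) (App center z0)).
Proof.
  apply tm_conv with (Id (App (Var 3) z0) (Var 2) (round I2 (Var 3) z0 z0 h00 (Var 2))).
  - by_subst (round_path_type K) [Var 2; h00; z0; z0; Var 3; I2].
  - apply eqty_Id; [apply eqty_refl; tc_auto | apply eq_tm_refl; tc_auto |].
    apply eq_tm_sym. apply (eq_beta K glue_ctx I2 (App (Var 4) (Var 0))); tc_auto.
Qed.

Lemma end0_type K :
  has_type K glue_ctx end0 (Id (App (Var 3) z0) (App center z0) (Var 2)).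
Proof.
  assert (H := center_path_type K).
  by_subst (cancel_type K)
    [Refl (Var 2); Var 2; center_path; App center z0; Var 2; App (Var 3) z0].
Qed.

Lemma end1_type K :
  has_type K glue_ctx end1 (Id (App (Var 3) z1) (App center z1) (Var 1)).
Proof.
  assert (H := center_path_type K).
  by_subst (reach_type K)
    [Var 0; Var 1; h01; z1; center_path; Var 2; center; z0; Var 3; I2].
Qed.

Definition glue : tm := int_ind (Var 3) center (Var 2) end0 (Var 1) end1.
Definition glue_path : tm := int_ind_path (Var 3) center (Var 2) end0 (Var 1) end1.

(** [apd_unique] along [h01] with k = q. Reflexivity proves its hypotheses because [glue_path]
    computes at both endpoints. *)
Definition glue_coherence : tm :=
  App (App
    (apd_unique I2 (Var 3) z0 center glue center_path glue_path
       (Refl (App glue_path z0)) z1 h01)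
    (Var 0)) (Refl (App glue_path z1)).

(** In [ends_ctx] the ends are variables, which keeps their types conversion-free; the actual ends,
    typed only up to conversion, enter here. *)
Ltac by_ends L :=
  let H0 := fresh in let H1 := fresh in
  assert (H0 := end0_type RecAndInd); assert (H1 := end1_type RecAndInd);
  by_subst L [end1; end0; center; Var 1; Var 2; Var 3].

Lemma glue_type : has_type RecAndInd glue_ctx glue (Pi I2 (App (Var 4) (Var 0))).
Proof. by_ends int_ind_type. Qed.

Lemma glue_path_type :
  has_type RecAndInd glue_ctx glue_path
    (Pi I2 (Id (App (Var 4) (Var 0)) (App (shift center) (Var 0)) (App (shift glue) (Var 0)))).
Proof. by_ends int_ind_path_type. Qed.

Lemma int_ind_B0 :
  eq_term RecAndInd ends_ctx (App the_ind z0) (Var 4) (App (Var 5) z0) /\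
  eq_term RecAndInd ends_ctx (App the_ind_path z0) (Var 1)
    (Id (App (Var 5) z0) (App (Var 2) z0) (Var 4)).
Proof. apply int_ind_comp; [tc_auto .. | exact ind_singl_B0]. Qed.

Lemma int_ind_B1 :
  eq_term RecAndInd ends_ctx (App the_ind z1) (Var 3) (App (Var 5) z1) /\
  eq_term RecAndInd ends_ctx (App the_ind_path z1) (Var 0)
    (Id (App (Var 5) z1) (App (Var 2) z1) (Var 3)).
Proof. apply int_ind_comp; [tc_auto .. | exact ind_singl_B1]. Qed.

Lemma glue_B0 : eq_term RecAndInd glue_ctx (App glue z0) (Var 2) (App (Var 3) z0).
Proof. by_ends (proj1 int_ind_B0). Qed.

Lemma glue_B1 : eq_term RecAndInd glue_ctx (App glue z1) (Var 1) (App (Var 3) z1).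
Proof. by_ends (proj1 int_ind_B1). Qed.

Lemma glue_path_B0 :
  eq_term RecAndInd glue_ctx (App glue_path z0) end0
    (Id (App (Var 3) z0) (App center z0) (Var 2)).
Proof. by_ends (proj2 int_ind_B0). Qed.

Lemma glue_path_B1 :
  eq_term RecAndInd glue_ctx (App glue_path z1) end1
    (Id (App (Var 3) z1) (App center z1) (Var 1)).
Proof. by_ends (proj2 int_ind_B1). Qed.

(** Application of a variable section, to be instantiated with [glue], which the checker cannot type
    itself. *)
Lemma section_App K :
  has_type K [Pi (Var 2) (App (Var 2) (Var 0)); Var 1; Arr (Var 0) U; U]
    (App (Var 0) (Var 1)) (App (Var 2) (Var 1)).
Proof. tc_auto. Qed.

Lemma homotopy_App K :
  has_type K [Pi (Var 4) (Id (App (Var 4) (Var 0)) (App (Var 2) (Var 0)) (App (Var 1) (Var 0)));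
              Pi (Var 3) (App (Var 3) (Var 0)); Pi (Var 2) (App (Var 2) (Var 0));
              Var 1; Arr (Var 0) U; U]
    (App (Var 0) (Var 3))
    (Id (App (Var 4) (Var 3)) (App (Var 2) (Var 3)) (App (Var 1) (Var 3))).
Proof. tc_auto. Qed.

(** [apd_unique] speaks of glue |0| and glue |1|, the conclusion of a0 and a1. Most of the proof
    moves the arguments, and at the end the result, across these judgmental equalities. *)
Lemma glue_coherence_type :
  has_type RecAndInd glue_ctx glue_coherence
    (Id (Id (App (Var 3) z1) (App (transport I2 (Var 3) z0 z1 h01) (Var 2)) (Var 1))
       (apd I2 (Var 3) glue z0 z1 h01) (Var 0)).
Proof.
  assert (Hc := center_type RecAndInd).
  assert (He := center_path_type RecAndInd).
  assert (Hg := glue_type). assert (Hs := glue_path_type).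
  assert (Hg0 : has_type RecAndInd glue_ctx (App glue z0) (App (Var 3) z0))
    by (by_subst (section_App RecAndInd) [glue; z0; Var 3; I2]).
  assert (Hg1 : has_type RecAndInd glue_ctx (App glue z1) (App (Var 3) z1))
    by (by_subst (section_App RecAndInd) [glue; z1; Var 3; I2]).
  assert (EP0 : eq_type RecAndInd glue_ctx (App (Var 3) z0) (App (Var 3) z0))
    by (apply eqty_refl; tc_auto).
  assert (EP1 : eq_type RecAndInd glue_ctx (App (Var 3) z1) (App (Var 3) z1))
    by (apply eqty_refl; tc_auto).
  assert (E0 := eq_tm_sym _ _ _ _ _ glue_B0). assert (E1 := eq_tm_sym _ _ _ _ _ glue_B1).
  assert (He' : has_type RecAndInd glue_ctx center_path
                  (Id (App (Var 3) z0) (App glue z0) (App center z0))).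
  { apply tm_conv with (1 := He).
    apply eqty_Id; [exact EP0 | exact E0 | apply eq_tm_refl; tc_auto]. }
  assert (Ek : eq_type RecAndInd glue_ctx
    (Id (App (Var 3) z1) (App (transport I2 (Var 3) z0 z1 h01) (Var 2)) (Var 1))
    (Id (App (Var 3) z1) (App (transport I2 (Var 3) z0 z1 h01) (App glue z0)) (App glue z1))).
  { apply eqty_Id; [exact EP1 | | exact E1].
    apply (eq_App RecAndInd glue_ctx (App (Var 3) z0) (App (Var 4) z1));
      [tc_auto | tc_auto | apply eq_tm_refl; tc_auto | exact E0]. }
  assert (Hk : has_type RecAndInd glue_ctx (Var 0)
    (Id (App (Var 3) z1) (App (transport I2 (Var 3) z0 z1 h01) (App glue z0)) (App glue z1))).
  { apply tm_conv with (2 := Ek). tc_auto. }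
  assert (Hs0 : has_type RecAndInd glue_ctx (App glue_path z0)
                  (Id (App (Var 3) z0) (App center z0) (App glue z0)))
    by (by_subst (homotopy_App RecAndInd) [glue_path; glue; center; z0; Var 3; I2]).
  assert (Hs1 : has_type RecAndInd glue_ctx (App glue_path z1)
                  (Id (App (Var 3) z1) (App center z1) (App glue z1)))
    by (by_subst (homotopy_App RecAndInd) [glue_path; glue; center; z1; Var 3; I2]).
  assert (HT0 : is_type RecAndInd glue_ctx (Id (App (Var 3) z0) (App center z0) (App glue z0)))
    by (apply ty_Id; [tc_auto | tc_auto | exact Hg0]).
  assert (HT1 : is_type RecAndInd glue_ctx (Id (App (Var 3) z1) (App center z1) (App glue z1)))
    by (apply ty_Id; [tc_auto | tc_auto | exact Hg1]).
  assert (ET0 : eq_type RecAndInd glue_ctx (Id (App (Var 3) z0) (App center z0) (Var 2))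
                  (Id (App (Var 3) z0) (App center z0) (App glue z0)))
    by (apply eqty_Id; [exact EP0 | apply eq_tm_refl; tc_auto | exact E0]).
  assert (ET1 : eq_type RecAndInd glue_ctx (Id (App (Var 3) z1) (App center z1) (Var 1))
                  (Id (App (Var 3) z1) (App center z1) (App glue z1)))
    by (apply eqty_Id; [exact EP1 | apply eq_tm_refl; tc_auto | exact E1]).
  assert (Hn : has_type RecAndInd glue_ctx (Refl (App glue_path z0))
    (Id (Id (App (Var 3) z0) (App center z0) (App glue z0)) (App glue_path z0)
       (cancel (App (Var 3) z0) (App glue z0) (App center z0) center_path (App glue z0)
          (Refl (App glue z0))))).
  { apply tm_conv with (1 := tm_Refl _ _ _ _ HT0 Hs0).
    apply eqty_Id; [apply eqty_refl; exact HT0 | apply eq_tm_refl; exact Hs0 |].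
    apply eq_conv with (2 := ET0). eapply eq_tm_trans; [exact glue_path_B0|].
    (* Replaces a0 by glue |0| in all arguments of [end0] where it is visible. *)
    by_cong (cancel_type RecAndInd)
      [Refl (Var 2); Var 2; center_path; App center z0; Var 2; App (Var 3) z0]
      [Refl (App glue z0); App glue z0; center_path; App center z0; App glue z0; App (Var 3) z0].
    apply eq_Refl; [tc_auto | exact E0]. }
  assert (Hm : has_type RecAndInd glue_ctx (Refl (App glue_path z1))
    (Id (Id (App (Var 3) z1) (App center z1) (App glue z1)) (App glue_path z1)
       (reach I2 (Var 3) z0 center (App glue z0) center_path z1 h01 (App glue z1) (Var 0)))).
  { apply tm_conv with (1 := tm_Refl _ _ _ _ HT1 Hs1).
    apply eqty_Id; [apply eqty_refl; exact HT1 | apply eq_tm_refl; exact Hs1 |].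
    apply eq_conv with (2 := ET1). eapply eq_tm_trans; [exact glue_path_B1|].
    by_cong (reach_type RecAndInd)
      [Var 0; Var 1; h01; z1; center_path; Var 2; center; z0; Var 3; I2]
      [Var 0; App glue z1; h01; z1; center_path; App glue z0; center; z0; Var 3; I2]. }
  set (motive := apd_unique_motive I2 (Var 3) z0 center glue center_path glue_path z1 h01).
  assert (HM : is_type RecAndInd glue_ctx motive).
  { apply (use_subst_type _ _ _ _
      [h01; z1; Refl (App glue_path z0); glue_path; center_path; glue; center; z0; Var 3; I2]
      _ (apd_unique_motive_type RecAndInd));
      [tc_auto | subst_ok_auto | vm_compute; reflexivity]. }
  assert (HJ : has_type RecAndInd glue_ctx
    (apd_unique I2 (Var 3) z0 center glue center_path glue_path
       (Refl (App glue_path z0)) z1 h01) motive)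
    by (by_subst (apd_unique_type RecAndInd)
      [h01; z1; Refl (App glue_path z0); glue_path; center_path; glue; center; z0; Var 3; I2]).
  assert (Hapd : has_type RecAndInd glue_ctx (apd I2 (Var 3) glue z0 z1 h01)
    (Id (App (Var 3) z1) (App (transport I2 (Var 3) z0 z1 h01) (App glue z0)) (App glue z1)))
    by (by_subst (apd_type RecAndInd) [h01; z1; glue; z0; Var 3; I2]).
  apply tm_conv with
    (Id (Id (App (Var 3) z1) (App (transport I2 (Var 3) z0 z1 h01) (App glue z0)) (App glue z1))
       (apd I2 (Var 3) glue z0 z1 h01) (Var 0)).
  (* The codomains are read off [motive] by inversion instead of being written out. *)
  - pose proof (App_type _ _ _ _ _ _ HJ HM Hk) as HJk.
    pose proof (Pi_type_inv _ _ _ _ HM) as [_ HM2].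
    pose proof (inst_type _ _ _ _ _ HM2 Hk) as HMk.
    exact (App_type _ _ _ _ _ _ HJk HMk Hm).
  - apply eqty_Id; [apply eqty_sym; exact Ek | |]; apply eq_tm_refl; assumption.
Qed.

(** * Substitution in the path operations, and instantiation in an arbitrary context *)

Lemma subst_ap s A B f a b p :
  subst s (ap A B f a b p)
  = ap (subst s A) (subst s B) (subst s f) (subst s a) (subst s b) (subst s p).
Proof. unfold ap, shift2. cbn [subst]. rewrite !subst_up_shift. reflexivity. Qed.

Lemma subst_transport s A P a b p :
  subst s (transport A P a b p)
  = transport (subst s A) (subst s P) (subst s a) (subst s b) (subst s p).
Proof.
  unfold transport, shift2. cbn [subst]. rewrite subst_Arr. cbn [subst].
  rewrite !subst_up_shift. reflexivity.
Qed.

Lemma subst_apd s A P g a b p :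
  subst s (apd A P g a b p)
  = apd (subst s A) (subst s P) (subst s g) (subst s a) (subst s b) (subst s p).
Proof.
  unfold apd, shift2. cbn [subst]. rewrite subst_transport, !subst_up_shift. reflexivity.
Qed.

Theorem theorem8p1 :
  (forall (K : trunc_elim) (G : ctx) (Y y0 y1 p : tm),
    has_type K G Y U ->
    has_type K G y0 Y ->
    has_type K G y1 Y ->
    has_type K G p (Id Y y0 y1) ->
    exists f,
      has_type K G f (Arr (Trunc Bool) Y) /\
      eq_term K G (App f (Tr B0)) y0 Y /\
      eq_term K G (App f (Tr B1)) y1 Y /\
      exists r,
        has_type K G r
          (Id (Id Y y0 y1)
              (ap (Trunc Bool) Y f (Tr B0) (Tr B1)
                  (trunc_path Bool (Tr B0) (Tr B1)))
              p))
  /\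
  (forall (G : ctx) (P a0 a1 q : tm),
    has_type RecAndInd G P (Arr (Trunc Bool) U) ->
    has_type RecAndInd G a0 (App P (Tr B0)) ->
    has_type RecAndInd G a1 (App P (Tr B1)) ->
    has_type RecAndInd G q
      (Id (App P (Tr B1))
          (App (transport (Trunc Bool) P (Tr B0) (Tr B1)
                  (trunc_path Bool (Tr B0) (Tr B1))) a0)
          a1) ->
    exists g,
      has_type RecAndInd G g (Pi (Trunc Bool) (App (shift P) (Var 0))) /\
      eq_term RecAndInd G (App g (Tr B0)) a0 (App P (Tr B0)) /\
      eq_term RecAndInd G (App g (Tr B1)) a1 (App P (Tr B1)) /\
      exists r,
        has_type RecAndInd G r
          (Id (Id (App P (Tr B1))
                  (App (transport (Trunc Bool) P (Tr B0) (Tr B1)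
                          (trunc_path Bool (Tr B0) (Tr B1))) a0)
                  a1)
              (apd (Trunc Bool) P g (Tr B0) (Tr B1)
                  (trunc_path Bool (Tr B0) (Tr B1)))
              q)).
Proof.
  split.
  - intros K G Y y0 y1 p HY H0 H1 Hp.
    assert (HG := has_type_wf _ _ _ _ HY).
    set (s := sub [p; y1; y0; Y]).
    assert (Hs : subst_ok K G s path_ctx)
      by (repeat apply subst_ok_cons; [apply subst_ok_nil | assumption ..]).
    exists (subst s int_rec).
    repeat split.
    + exact (subst_term _ _ _ _ _ _ (int_rec_type K) HG Hs).
    + exact (subst_eq_term _ _ _ _ _ _ _ (proj1 (int_rec_B0 K)) HG Hs).
    + exact (subst_eq_term _ _ _ _ _ _ _ (proj1 (int_rec_B1 K)) HG Hs).
    + destruct (int_rec_ap K) as [r Hr]. exists (subst s r).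
      apply subst_term with (s := s) (D := G) in Hr; auto.
      cbn [subst] in Hr. rewrite subst_ap in Hr. exact Hr.
  - intros G P a0 a1 q HP H0 H1 Hq.
    assert (HG := has_type_wf _ _ _ _ HP).
    set (s := sub [q; a1; a0; P]).
    assert (Hs : subst_ok RecAndInd G s glue_ctx)
      by (repeat apply subst_ok_cons; [apply subst_ok_nil | assumption ..]).
    exists (subst s glue).
    repeat split.
    + exact (subst_term _ _ _ _ _ _ glue_type HG Hs).
    + exact (subst_eq_term _ _ _ _ _ _ _ glue_B0 HG Hs).
    + exact (subst_eq_term _ _ _ _ _ _ _ glue_B1 HG Hs).
    + exists (subst s glue_coherence).
      assert (Hr := subst_term _ _ _ _ _ _ glue_coherence_type HG Hs).
      cbn [subst] in Hr. rewrite subst_apd, subst_transport in Hr. exact Hr.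
Qed.
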